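(* Let $n\geq 3$ and let $\omega\in\mathcal{U}\subseteq\mathscr{F}(\mathbb{P}^n,e)$. Then the Kupka scheme $\mathcal{K}(\omega)$ is connected.
   Context: Work over $\mathbb{C}$ and let $S=\mathbb{C}[x_0,\dots,x_n]$ be the homogeneous coordinate ring of $\mathbb{P}^n$. $\Omega^1_S$ is the free $S$-module of Kähler differentials of $S$ over $\mathbb{C}$ (basis $dx_0,\dots,dx_n$), $\Omega^2_S=\bigwedge^2\Omega^1_S$, and $T_S=(\Omega^1_S)^\vee$. A section $\omega\in H^0(\mathbb{P}^n,\Omega^1_{\mathbb{P}^n}(e))$ is identified with a form $\omega=\sum_{i=0}^n A_i\,dx_i\in\Omega^1_S$, with $A_i$ homogeneous of degree $e-1$ and $\sum_i x_iA_i=0$; $d\omega\in\Omega^2_S$ is its exterior derivative. $\mathscr{F}(\mathbb{P}^n,e)$ is the set of classes, in $\mathbb{P}(H^0(\Omega^1_{\mathbb{P}^n}(e)))$, of nonzero $\omega$ such that $\mathrm{Sing}(\omega)=\{p:\omega(p)=0\}$ has codimension $\geq 2$ and $\omega\wedge d\omega=0$. $I(\omega)=\{h\in S: h\,d\omega=\omega\wedge\eta\text{ for some }\eta\in\Omega^1_S\}$ and $J(\omega)=\{i_X(\omega): X\in T_S\}$ (the ideal generated by $A_0,\dots,A_n$). The Kupka scheme is $\mathcal{K}(\omega)=\mathrm{Proj}(S/K(\omega))$, where $K(\omega)=\mathrm{ann}(\overline{d\omega})+J(\omega)$ and $\overline{d\omega}$ is the class of $d\omega$ in $\Omega^2_S\otimes_S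 S/J(\omega)$. A point $\mathfrak{p}\in\mathbb{P}^n$ means a homogeneous prime ideal of $S$ different from the irrelevant ideal $(x_0,\dots,x_n)$. It is a division point of $\omega$ if $1\in I(\omega)_{\mathfrak{p}}$. Finally $$\mathcal{U}=\{\omega\in\mathscr{F}(\mathbb{P}^n,e):\ \text{every }\mathfrak{p}\notin\mathcal{K}(\omega)\text{ is a division point of }\omega\}.$$ *)

(* Defs.v *)
(* mpoly has to be imported before the classical_sets and topology files, whose
   notations otherwise clash with it. *)
From HB Require Import structures.
From mathcomp Require Import all_boot all_order all_algebra.
From mathcomp Require Import complex mpoly.
From mathcomp Require Import boolp classical_sets reals topology.

Set Implicit Arguments.
Unset Strict Implicit.
Unset Printing Implicit Defensive.

Import GRing.Theory.

Local Open Scope classical_set_scope.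
Local Open Scope ring_scope.

Section ProjectiveSpace.

Variables (F : fieldType) (n : nat).
Local Notation S := {mpoly F[n.+1]}.

Definition irrelevant_ideal : set S :=
  [set f | exists g : 'I_n.+1 -> S, f = \sum_(i < n.+1) g i * 'X_i].

Definition homogeneous_ideal (I : set S) : Prop :=
  forall (d : nat) (f : S), I f -> I (pihomog mdeg d f).

(* idealr_closed includes properness (1 is not a member). *)
Record proj_point := ProjPoint {
  pt_ideal : set S;
  pt_ideal_closed : idealr_closed (mem pt_ideal);
  pt_ideal_prime : prime_idealr_closed (mem pt_ideal);
  pt_ideal_homogeneous : homogeneous_ideal pt_ideal;
  pt_ideal_relevant : pt_ideal <> irrelevant_ideal }.

HB.instance Definition _ := gen_eqMixin proj_point.
HB.instance Definition _ := gen_choiceMixin proj_point.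

Definition zero_locus (A : set S) : set proj_point :=
  [set p | A `<=` pt_ideal p].

Definition zariski_open (U : set proj_point) : Prop :=
  exists A : set S, U = ~` zero_locus A.

Lemma zariski_openT : zariski_open setT.
Proof.
exists setT; apply/seteqP; split => // p _ /(_ 1 I) p1.
by case: (pt_ideal_closed p) => _ /negP + _; apply; apply/mem_set.
Qed.

Lemma zariski_openI (U V : set proj_point) :
  zariski_open U -> zariski_open V -> zariski_open (U `&` V).
Proof.
move=> [A ->] [B ->].
exists [set h | exists f g, [/\ A f, B g & h = f * g]].
apply/seteqP; split => p /=.
  move=> [/existsNP[f /not_implyP[Af pf]] /existsNP[g /not_implyP[Bg pg]]].
  move=> /(_ (f * g)) /(_ (ex_intro _ f (ex_intro _ g (And3 Af Bg erefl)))).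
  move=> /mem_set /(pt_ideal_prime (p := p)) /orP[] /set_mem; [exact: pf|exact: pg].
have pM a u : pt_ideal p u -> pt_ideal p (a * u).
  case: (pt_ideal_closed p) => p0 _ pD pu; apply/set_mem.
  by rewrite -[_ * _]addr0; apply: pD => //; apply/mem_set.
move=> np; split=> pA; apply: np => _ [f [g [Af Bg ->]]].
  by rewrite mulrC; apply: pM; apply: pA.
by apply: pM; apply: pA.
Qed.

Lemma zariski_open_bigU (I : Type) (U : I -> set proj_point) :
  (forall i, zariski_open (U i)) -> zariski_open (\bigcup_i U i).
Proof.
move=> /choice[A UA]; exists (\bigcup_i A i); apply/seteqP; split => p /=.
  move=> [i _]; rewrite UA => pi pU; apply: pi => f Af; apply: pU.
  by exists i.
move=> /existsNP[f /not_implyP[[i _ Af] pf]]; exists i => //.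
by rewrite UA => /(_ f Af).
Qed.

HB.instance Definition _ := isOpenTopological.Build proj_point
  zariski_openT zariski_openI zariski_open_bigU.

(* The irreducible closed subsets of P^n are the closures of its points, and
   closures of points are ordered by reverse inclusion of the ideals; so this
   says that every irreducible closed Y contained in Z starts a chain
   Y = Y_c, ..., Y_0 of strictly increasing irreducible closed subsets of P^n.
   The empty set has codimension >= c for all c. *)
Definition codim_ge (c : nat) (Z : set proj_point) : Prop :=
  forall p, Z p -> exists q : nat -> proj_point, q c = p /\
    forall i, (i < c)%N -> pt_ideal (q i) `<` pt_ideal (q i.+1).

(* I_p inside Frac S, for an ideal I of the domain S. *)
Definition localization_at (I : set S) (p : proj_point) : set {fraction S} :=
  [set x | exists h s : S,
    [/\ I h, ~ pt_ideal p s & x = tofrac h / tofrac s]].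

End ProjectiveSpace.

Section Forms.

Variables (F : fieldType) (n : nat).
Local Notation S := {mpoly F[n.+1]}.

(* A 1-form \sum_i A_i dx_i is the row (A_i); a 2-form
   \sum_(i < j) B_ij dx_i /\ dx_j is the alternating matrix (B_ij); a 3-form is
   given by its coefficients on dx_i /\ dx_j /\ dx_k, alternating in i, j, k.
   A vector field \sum_i X_i d/dx_i is the row (X_i). *)
Local Notation form1 := 'rV[S]_n.+1.
Local Notation form2 := 'M[S]_n.+1.
Local Notation vfield := 'rV[S]_n.+1.

Implicit Types (w eta : form1) (theta : form2) (X : vfield) (p : proj_point F n).

Definition exterior_d w : form2 :=
  \matrix_(i, j) (mderiv i (w 0 j) - mderiv j (w 0 i)).

Definition wedge11 w eta : form2 :=
  \matrix_(i, j) (w 0 i * eta 0 j - w 0 j * eta 0 i).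

Definition wedge12 w theta (i j k : 'I_n.+1) : S :=
  w 0 i * theta j k - w 0 j * theta i k + w 0 k * theta i j.

Definition contraction X w : S := \sum_(i < n.+1) X 0 i * w 0 i.

Definition radial_field : vfield := \row_i 'X_i.

(* H^0(P^n, Omega^1(e)). For e = 0, where e.-1 = 0, the second condition
   forces w = 0. *)
Definition twisted_form (e : nat) w : Prop :=
  (forall i, w 0 i \is (e.-1).-homog) /\ contraction radial_field w = 0.

Definition ideal_J w : set S := [set h | exists X, h = contraction X w].

Definition ideal_I w : set S :=
  [set h | exists eta, h *: exterior_d w = wedge11 w eta].

Definition sing w : set (proj_point F n) := zero_locus (ideal_J w).

(* The set of nonzero forms whose classes constitute F(P^n, e). *)
Definition foliation (e : nat) w : Prop :=
  [/\ twisted_form e w, w != 0, codim_ge 2 (sing w) &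
      forall i j k, wedge12 w (exterior_d w) i j k = 0].

(* Omega^2_S is free on the dx_i /\ dx_j, i < j, so a 2-form is zero in
   Omega^2_S (x) S/J iff its coefficients are in J. *)
Definition ann_d w : set S :=
  [set h | forall i j, ideal_J w ((h *: exterior_d w) i j)].

Definition ideal_K w : set S :=
  [set h | exists a b, [/\ ann_d w a, ideal_J w b & h = a + b]].

(* Underlying space of Proj (S / K(w)), as a closed subspace of P^n. *)
Definition kupka w : set (proj_point F n) := zero_locus (ideal_K w).

Definition division_point w p : Prop := localization_at (ideal_I w) p 1.

Definition in_U (e : nat) w : Prop :=
  foliation e w /\ forall p, ~ kupka w p -> division_point w p.

End Forms.

(* Main.v *)
Require Import Defs.
From HB Require Import structures.
From mathcomp Require Import all_boot all_order all_algebra.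
From mathcomp Require Import complex mpoly ring.
From mathcomp Require Import boolp classical_sets reals topology.

(** Let I be the ideal of the h such that h dw is a multiple of w, and let J be
    the ideal of the coefficients of w. The support of the Kupka scheme is the
    zero locus of I: a point off the Kupka scheme is a division point, and
    h dw = w /\ eta shows that h annihilates dw modulo J. So the statement is
    about the zero locus of I.

    Depth. Since the singular locus has codimension at least two and polynomial
    rings are factorial, the coefficients of w have no common factor, so that
    w /\ eta = 0 only if eta is a multiple of w (wedge11_eq0). Hence
    S -> Omega^1 -> Omega^2 resolves M = Omega^2 / (w /\ Omega^1), and M has
    projective dimension at most two. As n + 1 >= 4, the local cohomology of M at
    the irrelevant ideal vanishes in degrees zero and one; this is proved with
    Koszul cochains (coker_depth1, coker_depth2). In degree zero, it shows that
    the zero locus of I is not empty, for otherwise dw would be a multiple of w,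
    and the contraction with the radial field R would contradict Euler's formula
    i_R dw = e w. The same argument with the n >= 3 equations of a closed point
    shows that the zero locus of I has no isolated closed point
    (nonlinear_point_below).

    Splitting. If the zero locus of I is the disjoint union of nonempty closed
    subsets Z1 and Z2, the product of dw and the function equal to 0 on Z1 and 1
    on Z2 is a section of M off the irrelevant ideal, so it comes from a two-form
    theta. Near Z1 the form theta is divisible by w, and near Z2 so is dw - theta.
    By contraction i_R theta = c w; if theta is chosen homogeneous, then c is a
    constant, and in general only the constant coefficient of c matters.

    Residues. Near Z1 write theta = w /\ s; then c = - i_R s. Because w vanishes on
    Z1, the row s is well defined there, and its entries are sections of O(-1) on
    Z1. On an integral projective variety of positive dimension over an
    algebraically closed field O(-1) has no nonzero section, whence c = 0
    (residue_linear_point). In the same way e - c = 0 on Z2. This is absurd in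
    characteristic zero (zero_locus_connected). *)

Set Implicit Arguments.
Unset Strict Implicit.
Unset Printing Implicit Defensive.

Import GRing.Theory.

Local Open Scope classical_set_scope.
Local Open Scope ring_scope.
Local Open Scope complex_scope.

(** * Factoriality of polynomial rings *)

Section Factoriality.

Let unit_neq0 (R : idomainType) (u : R) : u \is a GRing.unit -> u != 0.
Proof. by apply: contraTneq => ->; rewrite unitr0. Qed.

Definition divides (R : idomainType) (a b : R) := exists c, b = c * a.

Definition prime_elt (R : idomainType) (p : R) :=
  [/\ p != 0, p \isn't a GRing.unit &
      forall a b, divides p (a * b) -> divides p a \/ divides p b].

Definition factors (R : idomainType) (a : R) := exists u (s : seq R),
  [/\ u \is a GRing.unit, forall p, p \in s -> prime_elt p &
      a = u * \prod_(p <- s) p].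

Definition factorial (R : idomainType) := forall a : R, a != 0 -> factors a.

Lemma factorsM (R : idomainType) (a b : R) :
  factors a -> factors b -> factors (a * b).
Proof.
move=> [u [s [uu ps ->]]] [v [t [vu pt ->]]]; exists (u * v), (s ++ t); split.
- by rewrite unitrM uu.
- by move=> p; rewrite mem_cat => /orP[/ps|/pt].
- by rewrite big_cat mulrACA.
Qed.

Lemma factors_unit (R : idomainType) (u : R) :
  u \is a GRing.unit -> factors u.
Proof. by move=> uu; exists u, [::]; split=> //; rewrite big_nil mulr1. Qed.

Lemma factors_prime (R : idomainType) (p : R) : prime_elt p -> factors p.
Proof.
move=> pp; exists 1, [:: p]; split; first exact: unitr1.
  by move=> q; rewrite inE => /eqP->.
by rewrite big_seq1 mul1r.
Qed.

Lemma factorial_ind (R : idomainType) (P : R -> Prop) : factorial R ->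
    (forall u, u \is a GRing.unit -> P u) ->
    (forall p a, prime_elt p -> a != 0 -> P a -> P (p * a)) ->
  forall a, a != 0 -> P a.
Proof.
move=> facR Pu Pp a a0; have [u [s [uu ps ea]]] := facR _ a0.
suff: P a /\ a != 0 by case.
rewrite {a a0}ea; elim: s ps => [|p s IH] ps.
  by rewrite big_nil mulr1; split; [exact: Pu|exact: unit_neq0].
have [|Ps s0] := IH; first by move=> q qs; apply: ps; rewrite inE qs orbT.
have pp : prime_elt p by apply: ps; rewrite mem_head.
rewrite big_cons mulrCA; split; first exact: Pp.
by rewrite mulf_neq0 //; case: pp.
Qed.

Lemma factorial_field (F : fieldType) : factorial F.
Proof. by move=> a a0; apply: factors_unit; rewrite unitfE. Qed.

Lemma divides_polyC (R : idomainType) (a : R) (f : {poly R}) :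
  divides a%:P f <-> forall i, divides a f`_i.
Proof.
split=> [[g ->] i|/choice[c fc]]; first by exists g`_i; rewrite coefMC.
exists (\poly_(i < size f) c i); apply/polyP => i.
rewrite coefMC coef_poly; case: ltnP => [_|fi]; first exact: fc.
by rewrite mul0r nth_default.
Qed.

Lemma prime_polyC (R : idomainType) (p : R) : prime_elt p -> prime_elt p%:P.
Proof.
case=> p0 pu pp; split; first by rewrite polyC_eq0.
  by rewrite poly_unitE coefC size_polyC p0 eqxx.
move=> f g /divides_polyC pfg.
apply: contrapT => /not_orP[/divides_polyC nf /divides_polyC ng].
(* Gauss: look at the first coefficients of f and g that p does not divide. *)
have first_coef (h : {poly R}) : ~ (forall i, divides p h`_i) ->
    exists i, ~ divides p h`_i /\ forall j, (j < i)%N -> divides p h`_j.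
  move=> /existsNP[i0 ni0].
  have ex : exists i, ~~ `[< divides p h`_i >] by exists i0; apply/asboolPn.
  exists (ex_minn ex); case: ex_minnP => i /asboolPn ni imin; split=> // j ji.
  by apply: contrapT => /asboolPn/imin; rewrite leqNgt ji.
have [i [ni mini]] := first_coef _ nf; have [j [nj minj]] := first_coef _ ng.
have : divides p (f`_i * g`_j).
  have := pfg (i + j)%N; rewrite coefM.
  have iij : (i < (i + j).+1)%N by rewrite ltnS leq_addr.
  rewrite (bigD1 (Ordinal iij)) //= addKn => -[c e].
  suff [d ds] : divides p (\sum_(k < (i + j).+1 | k != Ordinal iij)
      f`_k * g`_(i + j - k)).
    by exists (c - d); rewrite mulrBl -ds -e addrK.
  elim/big_ind: _ => [|_ _ [x ->] [y ->]|k]; first by exists 0; rewrite mul0r.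
    by exists (x + y); rewrite mulrDl.
  rewrite -val_eqE /= => kni; case: (ltngtP k i) kni => // ki _.
    by have [x ->] := mini _ ki; exists (x * g`_(i + j - k)); ring.
  have [x ->] : divides p g`_(i + j - k).
    by apply: minj; rewrite ltn_subLR ?ltn_add2r // -ltnS.
  by exists (f`_k * x); ring.
by move=> /pp[/ni|/nj].
Qed.

Definition primitive (R : idomainType) (f : {poly R}) :=
  forall p, prime_elt p -> ~ divides p%:P f.

Lemma gauss (R : idomainType) (a : R) (f g : {poly R}) : factorial R ->
  a != 0 -> primitive f -> divides a%:P (f * g) -> divides a%:P g.
Proof.
move=> facR a0 prf; move: a a0 g; apply: factorial_ind => //.
  by move=> u uu g _; exists (u^-1%:P * g); rewrite mulrAC -polyCM mulVr ?mul1r.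
move=> p a pp a0 IH g [h]; rewrite polyCM => e.
have [p0 _ pdiv] := prime_polyC pp.
have [||[g' eg']] := pdiv f g; first by exists (h * a%:P); rewrite e; ring.
  by move/prf.
have [|g'' eg''] := IH g'; last by exists g''; rewrite eg' eg''; ring.
exists h; apply: (mulIf p0).
transitivity (f * g); first by rewrite eg' mulrA.
by rewrite e; ring.
Qed.

Lemma primitive_part (R : idomainType) (f : {poly R}) : factorial R ->
  f != 0 -> exists c f0, [/\ c != 0, primitive f0 & f = c%:P * f0].
Proof.
move=> facR f0.
(* The coefficient a bounds the content of the polynomial g from which prime
   constants are still to be extracted. *)
suff cl (a : R) : a != 0 -> forall g : {poly R}, g != 0 ->
    (forall c, divides c%:P g -> divides c a) ->
    exists c g0, [/\ c != 0, primitive g0 & g = c%:P * g0].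
  apply: (cl (lead_coef f)); rewrite ?lead_coef_eq0 //.
  by move=> c /divides_polyC cf; apply: cf.
move: a; apply: factorial_ind => //.
  move=> u uu g g0 gc; exists 1, g; rewrite oner_neq0 mul1r; split=> // p pp.
  move=> /gc[d e]; case: pp => _ /negP; case.
  by move: uu; rewrite e unitrM => /andP[].
move=> p a pp a0 IH g g0 gc; have [p0 pu pdiv] := pp.
have [[g' eg]|npg] := pselect (divides p%:P g).
  have g'0 : g' != 0 by apply: contraNneq g0; rewrite eg => ->; rewrite mul0r.
  have [c [d e]|c [g1 [c0 prg1 e]]] := IH g' g'0.
    have [|x ex] := gc (p * c); first by exists d; rewrite eg e polyCM; ring.
    by exists x; apply: (mulfI p0); rewrite ex mulrCA.
  exists (p * c), g1; rewrite mulf_neq0 //; split=> //.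
  by rewrite eg e polyCM; ring.
apply: IH => // c cg; have [d e] := gc _ cg.
have [|[d' ed]|[x ex]] := pdiv d c; first by exists a; rewrite -e mulrC.
  by exists d'; apply: (mulfI p0); rewrite e ed; ring.
by case: npg; case: cg => y ->; exists (y * x%:P); rewrite ex polyCM; ring.
Qed.

Lemma primitive_unit (R : idomainType) (k : R) (f : {poly R}) : factorial R ->
  k != 0 -> primitive f -> divides k%:P f -> k \is a GRing.unit.
Proof.
move=> facR k0 prf kf; have [u [[|p s] [uu ps ek]]] := facR _ k0.
  by rewrite ek big_nil mulr1.
have [] := prf p; first by apply: ps; rewrite mem_head.
case: kf => h ->; exists (h * (u * \prod_(q <- s) q)%:P).
by rewrite ek big_cons -mulrA -polyCM; congr (_ * _%:P); ring.
Qed.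

(** A Bezout combination of f and g of least degree divides both, up to
    constants, by pseudo-division. *)
Lemma prime_primitive (R : idomainType) (f : {poly R}) : factorial R ->
    primitive f -> (1 < size f)%N ->
    (forall g, divides g f -> (size g <= 1)%N \/ size g = size f) ->
  prime_elt f.
Proof.
move=> facR prf sf irr; have f0 : f != 0 by rewrite -size_poly_gt0 ltnW.
split=> //; first by rewrite poly_unitE gtn_eqF.
move=> g h [w efg].
pose comb d := exists u v, d = u * f + v * g.
have combf : comb f by exists 1, 0; ring.
have combg : comb g by exists 0, 1; ring.
have ex : exists k, `[< exists2 d, comb d & d != 0 /\ size d = k >].
  by exists (size f); apply/asboolP; exists f.
have := @ex_minnP _ ex; case=> k /asboolP[d combd [d0 <-]] dmin {k}.
have [c [e [c0 pre ed]]] := primitive_part facR d0.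
have divd x : comb x -> divides e x.
  move=> combx; have := Pdiv.Idomain.divp_eq x d.
  set q := (_ %/ _)%R; set r := (_ %% _)%R => eqx.
  set l := lead_coef d ^+ _ in eqx.
  have r0 : r = 0.
    apply: contrapT => /eqP r0.
    have := ltn_modp x d; rewrite d0 -/r ltnNge => /negP; apply; apply: dmin.
    apply/asboolP; exists r => //.
    case: combx combd eqx => u [v ->] [u' [v' ->]] eqx.
    exists (l *: u - q * u'), (l *: v - q * v').
    by apply: (addrI (q * (u' * f + v' * g))); rewrite -eqx -!mul_polyC; ring.
  have l0 : l != 0 by rewrite expf_neq0 // lead_coef_eq0.
  have [|y ey] := @gauss _ l e (q * c%:P) facR l0 pre.
    by exists x; rewrite [RHS]mulrC mul_polyC eqx r0 addr0 ed; ring.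
  exists y; have lP0 : l%:P != 0 by rewrite polyC_eq0.
  apply: (mulfI lP0).
  rewrite mul_polyC eqx r0 addr0 ed; transitivity (q * c%:P * e); first by ring.
  by rewrite ey; ring.
have [y ey] := divd _ combf.
have e0 : e != 0 by apply: contraNneq f0; rewrite ey => ->; rewrite mulr0.
have [] := irr e; first by exists y.
- move=> se; right.
  have [k ek] : exists k, d = k%:P.
    have : (size d <= 1)%N by rewrite ed mul_polyC size_scale.
    by move=> /size1_polyC ->; eexists.
  have k0 : k != 0 by move: d0; rewrite ek polyC_eq0.
  case: combd => u [v euv].
  have ehk : f * (u * h + v * w) = h * k%:P.
    rewrite -ek euv; transitivity (u * f * h + v * (w * f)); first by ring.
    by rewrite -efg; ring.
  have [|x ex'] := @gauss _ k f (u * h + v * w) facR k0 prf; first by exists h.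
  exists x; have kP0 : k%:P != 0 by rewrite polyC_eq0.
  apply: (mulfI kP0); rewrite mulrC -ehk ex'; ring.
- move=> se; left.
  have sy : size y = 1.
    have y0 : y != 0 by apply: contraNneq f0; rewrite ey => ->; rewrite mul0r.
    move: (congr1 (fun t : {poly R} => size t) ey); rewrite size_mul // se.
    move: sf; case: (size f) => // m _; rewrite addnS /= => /eqP.
    by rewrite -[X in X == _]add1n eqn_add2r => /eqP.
  have /eqP/size_poly1P[k k0 eyk] := sy.
  have ku : k \is a GRing.unit.
    by apply: (primitive_unit facR k0 prf); exists e; rewrite ey eyk mulrC.
  have [z ->] := divd _ combg; exists (z * k^-1%:P).
  by rewrite ey eyk mulrA -(mulrA z) -polyCM mulVr // mulr1.
Qed.

Theorem factorial_poly (R : idomainType) : factorial R -> factorial {poly R}.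
Proof.
move=> facR f; have [m] := ubnP (size f).
elim: m f => // m IH f; rewrite ltnS => sfm f0.
have [c [g [c0 prg ef]]] := primitive_part facR f0.
have g0 : g != 0 by apply: contraNneq f0; rewrite ef => ->; rewrite mulr0.
have sfg : size f = size g by rewrite ef mul_polyC size_scale.
rewrite ef; apply: factorsM.
  have [u [s [uu ps ->]]] := facR _ c0; exists u%:P, [seq p%:P | p <- s].
  split; first by rewrite poly_unitE coefC size_polyC eqxx uu unit_neq0.
    by move=> _ /mapP[p /ps pp ->]; exact: prime_polyC.
  by rewrite polyCM rmorph_prod big_map.
have [sg|sg] := leqP (size g) 1.
  move: g0 prg; rewrite (size1_polyC sg) polyC_eq0 => k0 prg.
  apply: factors_unit; rewrite poly_unitE coefC size_polyC k0 eqxx /=.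
  by apply: (primitive_unit facR k0 prg); exists 1; rewrite mul1r.
have [irr|] := pselect (forall h, divides h g ->
    (size h <= 1)%N \/ size h = size g).
  exact/factors_prime/prime_primitive.
move=> /existsNP[h /not_implyP[[k ek] /not_orP[/negP + /eqP sh]]].
rewrite -ltnNge => sh1.
have h0 : h != 0 by rewrite -size_poly_gt0 ltnW.
have k0 : k != 0 by apply: contraNneq g0; rewrite ek => ->; rewrite mul0r.
have skh : size g = (size k + size h).-1 by rewrite ek size_mul.
have sk1 : (0 < size k)%N by rewrite size_poly_gt0.
have shg : (size h < size g)%N.
  rewrite ltn_neqAle sh /= skh; move: sk1; case: (size k) => // x _.
  by rewrite addSn leq_addl.
have skg : (size k < size g)%N.
  rewrite skh; move: sh1 sk1; case: (size h) => [|[|y]] // _ _.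
  by rewrite !addnS /= ltnS leq_addr.
rewrite ek; apply: factorsM; apply: IH => //; apply: leq_trans sfm;
  by rewrite sfg.
Qed.

Lemma factorial_iso (A B : idomainType) (phi : {rmorphism A -> B})
    (psi : {rmorphism B -> A}) :
  cancel phi psi -> cancel psi phi -> factorial A -> factorial B.
Proof.
move=> phiK psiK facA b b0.
have [|u [s [uu ps e]]] := facA (psi b).
  by apply: contraNneq b0 => e; rewrite -(psiK b) e rmorph0.
exists (phi u), [seq phi p | p <- s]; split; first exact: rmorph_unit.
  move=> _ /mapP[p /ps[p0 pu pp] ->]; split.
  - by apply: contraNneq p0 => e'; rewrite -(phiK p) e' rmorph0.
  - by apply: contraNN pu => e'; rewrite -(phiK p) rmorph_unit.
  - move=> x y [z ez]; have [|[c ec]|[c ec]] := pp (psi x) (psi y).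
    + by exists (psi z); rewrite -rmorphM ez rmorphM phiK.
    + by left; exists (phi c); rewrite -rmorphM -ec psiK.
    + by right; exists (phi c); rewrite -rmorphM -ec psiK.
by rewrite big_map -rmorph_prod -rmorphM -e psiK.
Qed.

Lemma mpoly_rmorph_id (R : comNzRingType) n
    (f : {rmorphism {mpoly R[n]} -> {mpoly R[n]}}) :
  (forall c, f c%:MP = c%:MP) -> (forall i, f 'X_i = 'X_i) -> f =1 id.
Proof.
move=> fC fX p; elim/mpolyind: p => [|c m p _ _ IH]; first by rewrite rmorph0.
rewrite rmorphD IH -mul_mpolyC rmorphM fC mpolyXE_id rmorph_prod.
congr (_ * _ + _); apply: eq_bigr => i _.
by rewrite rmorphXn fX.
Qed.

Lemma factorial_mpoly (F : fieldType) (n : nat) : factorial {mpoly F[n]}.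
Proof.
elim: n => [|n IH].
  pose phi : {rmorphism F -> {mpoly F[0]}} := @mpolyC 0 F.
  pose psi : {rmorphism {mpoly F[0]} -> F} := @meval 0 F (fun=> 0).
  apply: (@factorial_iso _ _ phi psi); last exact: factorial_field.
    by move=> c; rewrite /phi /psi /= mevalC.
  move=> p; elim/mpolyind: p => [|c m p _ _ IHp]; first by rewrite !rmorph0.
  rewrite !rmorphD /= IHp; congr (_ + _).
  by rewrite mevalZ (_ : m = 0%MM) ?mpolyX0 ?meval1 ?mulr1 ?alg_mpolyC //;
    apply/mnmP => -[].
pose psi : {rmorphism {mpoly F[n.+1]} -> {poly {mpoly F[n]}}} := @muni n F.
pose phi : {rmorphism {poly {mpoly F[n]}} -> {mpoly F[n.+1]}} :=
  horner_eval ('X_ord_max : {mpoly F[n.+1]}) \o @mpwiden n F.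
have psiX (m : 'X_{1..n.+1}) : psi 'X_[m] =
    'X_[[multinom (m (widen_ord (leqnSn n) i)) | i < n]] *: 'X^(m ord_max).
  by rewrite /psi /= muniE msuppX big_seq1 mcoeffX eqxx scale1r.
have mm (m : 'X_{1..n.+1}) : (mnmwiden
     [multinom (m (widen_ord (leqnSn n) i)) | i < n] + U_(ord_max) *+ m ord_max
   = m)%MM.
  apply/mnmP => i; rewrite mnmDE mulmnE mnm1E; case: (unliftP ord_max i).
    move=> j ->; rewrite (_ : lift _ _ = widen_ord (leqnSn n) j).
      rewrite mnmwiden_widen mnmE -val_eqE /=.
      by rewrite gtn_eqF ?mul0n ?addn0.
    by apply/val_inj; rewrite /= /bump leqNgt ltn_ord.
  by move=> ->; rewrite mnmwiden_ordmax eqxx mul1n.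
apply: (@factorial_iso _ _ phi psi); last exact: factorial_poly.
  move=> p; elim/poly_ind: p => [|p c IHp]; first by rewrite !rmorph0.
  rewrite (rmorphD phi) (rmorphD psi) (rmorphM phi) (rmorphM psi) IHp.
  congr (_ * _ + _).
    rewrite /phi /= mpwidenX /horner_eval hornerX psiX mnm1E eqxx expr1.
    rewrite (_ : [multinom _ | _ < _] = 0%MM) ?mpolyX0 ?scale1r //.
    by apply/mnmP => i; rewrite mnmE mnm1E mnm0E -val_eqE /= gtn_eqF.
  rewrite /phi /= mpwidenC /horner_eval hornerC.
  elim/mpolyind: c => [|c m q _ _ IHq]; first by rewrite !rmorph0.
  rewrite !rmorphD /= IHq; congr (_ + _).
  rewrite mwidenZ mwidenX muniZ psiX mnmwiden_ordmax expr0.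
  rewrite -mul_polyC (_ : [multinom _ | _ < _] = m); last first.
    by apply/mnmP => i; rewrite mnmE mnmwiden_widen.
  by rewrite alg_polyC -polyCM mul_mpolyC.
apply: (@mpoly_rmorph_id _ _ (phi \o psi)) => [c|i] /=.
  by rewrite muniC /phi /= mpwidenC /horner_eval hornerC mwidenC.
rewrite -/(psi 'X_i) psiX /phi /= mpwidenZ /horner_eval hornerZ rmorphXn /=.
by rewrite mpwidenX hornerXn mwidenX mpolyXn -mpolyXD mm.
Qed.

End Factoriality.

(** * Homogeneous ideals and points of projective space *)

Section HomogeneousIdeals.

Variables (F : fieldType) (n : nat).
Local Notation S := {mpoly F[n.+1]}.
Local Notation comp d f := (pihomog (@mdeg n.+1) d f).

Implicit Types (f g h u v : S) (I T : set S) (p q : proj_point F n).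

Lemma comp_sum f : f = \sum_(d < msize f) comp d f.
Proof. exact: pihomog_partitionE. Qed.

Lemma compM d k f g : f \is d.-homog ->
  comp k (f * g) = if (d <= k)%N then f * comp (k - d) g else 0.
Proof.
move=> fd; rewrite {1}[g]comp_sum mulr_sumr raddf_sum /=.
have fg j : f * comp j g \is (d + j).-homog.
  by apply: dhomogM => //; exact: pihomogP.
case: leqP => dk; last first.
  apply: big1 => j _; apply: pihomog_ne0 (fg j).
  by rewrite gtn_eqF // ltn_addr.
rewrite (eq_bigr (fun j : 'I_(msize g) =>
    f * (if val j == (k - d)%N then comp j g else 0))); last first.
  move=> j _; have [jk|jk] := eqVneq (val j) (k - d)%N.
    by apply: pihomog_dE; rewrite -(subnKC dk) -jk.
  rewrite mulr0; apply: pihomog_ne0 (fg j); apply: contraNneq jk => <-.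
  by rewrite addKn.
rewrite -mulr_sumr; congr (_ * _).
rewrite [in RHS](comp_sum g) raddf_sum /=; apply: eq_bigr => j _.
have [->|jk] := eqVneq (val j) (k - d)%N; first by rewrite pihomog_id.
by rewrite (pihomog_ne0 jk) // pihomogP.
Qed.

Lemma mcoeff_comp d f m : (comp d f)@_m = if mdeg m == d then f@_m else 0.
Proof.
elim/mpolyind: f => [|c m' f _ _ IH]; first by rewrite raddf0 mcoeff0 if_same.
rewrite pihomogD linearZ /= pihomogX !mcoeffD IH !mcoeffZ mcoeffX /=.
have [<-|mm'] := eqVneq m' m.
  by case: ifP => _; rewrite ?mcoeffX ?eqxx // mcoeff0 mulr0 add0r.
case: (mdeg m' == d); rewrite ?mcoeffX ?(negbTE mm') ?mcoeff0 mulr0 add0r;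
  by case: ifP => _; rewrite ?add0r ?mulr0 ?add0r.
Qed.

Lemma comp0E f : comp 0 f = (f@_0%MM)%:MP.
Proof.
apply/mpolyP => m; rewrite mcoeffC mcoeff_comp mdeg_eq0.
by case: eqVneq => [->|]; rewrite ?mulr1 ?mulr0.
Qed.

Definition hideal I :=
  [/\ I 0, forall u v, I u -> I v -> I (u + v), forall a u, I u -> I (a * u) &
      homogeneous_ideal I].

Lemma hideal_sum I (J : Type) (r : seq J) (P : pred J) (f : J -> S) :
  hideal I -> (forall i, P i -> I (f i)) -> I (\sum_(i <- r | P i) f i).
Proof. by move=> [I0 ID _ _] If; apply: big_ind. Qed.

Lemma hidealN I u : hideal I -> I u -> I (- u).
Proof. by move=> [_ _ IM _] Iu; rewrite -mulN1r; apply: IM. Qed.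

Lemma hidealB I u v : hideal I -> I u -> I v -> I (u - v).
Proof.
by move=> HI Iu Iv; have [_ ID _ _] := HI; apply: ID => //; exact: hidealN.
Qed.

(** Compare the lowest components of u and v that are outside of I. *)
Lemma hideal_prime I : hideal I ->
    (forall d k u v, u \is d.-homog -> v \is k.-homog -> I (u * v) ->
       I u \/ I v) ->
  forall u v, I (u * v) -> I u \/ I v.
Proof.
move=> HI Ip u v Iuv; have [I0 ID IM Ih] := HI.
apply: contrapT => /not_orP[nu nv].
have lowest f : ~ I f ->
    exists i, ~ I (comp i f) /\ forall j, (j < i)%N -> I (comp j f).
  move=> nf; have ex : exists i, ~~ `[< I (comp i f) >].
    apply: contrapT => /forallNP If; apply: nf; rewrite [f]comp_sum.
    by apply: hideal_sum => // i _; have /negP/negPn/asboolP := If i.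
  exists (ex_minn ex); case: ex_minnP => i /asboolPn ni imin; split=> // j ji.
  by apply: contrapT => /asboolPn/imin; rewrite leqNgt ji.
have [i [ni mini]] := lowest _ nu; have [j [nj minj]] := lowest _ nv.
have : I (comp i u * comp j v).
  have iu : (i < msize u)%N.
    rewrite ltnNge; apply/negP => ui; apply: ni.
    rewrite [u]comp_sum raddf_sum /=; apply: hideal_sum => // a _.
    have ai : (a < i)%N by apply: leq_trans ui.
    by rewrite (pihomog_ne0 _ (pihomogP _ a _)) // ltn_eqF.
  have := Ih (i + j)%N _ Iuv.
  rewrite [X in X * v](comp_sum u) mulr_suml raddf_sum /=.
  rewrite (bigD1 (Ordinal iu)) //=.
  rewrite (compM _ _ (pihomogP _ _ _)) leq_addr addKn => Is.
  rewrite -[_ * _](addrK (\sum_(a < msize u | a != Ordinal iu)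
    comp (i + j) (comp a u * v))).
  apply: hidealB => //; apply: hideal_sum => // a; rewrite -val_eqE /= => ai.
  rewrite (compM _ _ (pihomogP _ _ _)); case: leqP => // aij.
  case: (ltngtP a i) ai => // ai _.
    by rewrite mulrC; apply: IM; exact: mini.
  by apply: IM; apply: minj; rewrite ltn_subLR // ltn_add2r.
by move=> /(Ip _ _ _ _ (pihomogP _ _ _) (pihomogP _ _ _))[].
Qed.

(** A homogeneous ideal maximal among those disjoint from T is prime: adding a
    homogeneous element to it creates an intersection with T. *)
Lemma exists_hprime I T : hideal I -> T 1 ->
    (forall s t, T s -> T t -> T (s * t)) ->
    (forall t, T t -> exists d, t \is d.-homog) ->
    (forall t, T t -> ~ I t) ->
  exists P, [/\ hideal P, I `<=` P, forall t, T t -> ~ P t &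
                forall u v, P (u * v) -> P u \/ P v].
Proof.
move=> HI T1 TM Th TI.
pose good (Y : set S) := hideal (Y `|` I) /\ forall t, T t -> ~ (Y `|` I) t.
have [F' Fgood Ftot|A [[HA TA] Amax]] := @Zorn_bigcup S good.
  have ofI u : I u -> (\bigcup_(X in F') X `|` I) u by right.
  have ofX X u : F' X -> (X `|` I) u -> (\bigcup_(X in F') X `|` I) u.
    by move=> FX [Xu|]; [left; exists X|exact: ofI].
  have toX u : (\bigcup_(X in F') X `|` I) u ->
      I u \/ exists2 X, F' X & (X `|` I) u.
    by move=> [[X FX Xu]|]; [right; exists X => //; left|left].
  have [I0 ID IM Ih] := HI; split; last first.
    move=> t Tt /toX[It|[X FX]]; first exact: TI It.
    by have [_] := Fgood _ FX; apply.
  split=> [|u v||].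
  - exact: ofI.
  - move=> /toX[Iu|[X FX Xu]] /toX[Iv|[Y FY Yv]].
    + by apply: ofI; apply: ID.
    + have [[_ YD _ _] _] := Fgood _ FY; apply: (ofX Y) => //.
      by apply: YD => //; right.
    + have [[_ XD _ _] _] := Fgood _ FX; apply: (ofX X) => //.
      by apply: XD => //; right.
    + have [[_ XD _ _] _] := Fgood _ FX; have [[_ YD _ _] _] := Fgood _ FY.
      have [XY|YX] := Ftot _ _ FX FY.
        by apply: (ofX Y) => //; apply: YD => //; case: Xu => [/XY|] Xu; [left|right].
      by apply: (ofX X) => //; apply: XD => //; case: Yv => [/YX|] ?; [left|right].
  - move=> a u /toX[Iu|[X FX Xu]]; first by apply: ofI; apply: IM.
    by have [[_ _ XM _] _] := Fgood _ FX; apply: (ofX X) => //; apply: XM.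
  - move=> d u /toX[Iu|[X FX Xu]]; first by apply: ofI; apply: Ih.
    by have [[_ _ _ Xh] _] := Fgood _ FX; apply: (ofX X) => //; apply: Xh.
exists (A `|` I); split=> //.
set P := A `|` I in HA TA *; have [P0 PD PM Ph] := HA.
have Pmax f d : f \is d.-homog -> ~ P f ->
    exists t x a, [/\ T t, P x & t = x + a * f].
  move=> fd nf; apply: contrapT => nt.
  pose Q : set S := [set u | exists x a, P x /\ u = x + a * f].
  have QI : Q `|` I = Q.
    apply/seteqP; split=> u; last by left.
    by case=> // Iu; exists u, 0; rewrite mul0r addr0; split=> //; right.
  apply: (Amax Q).
    split=> [u Au|QA].
      by exists u, 0; rewrite mul0r addr0; split=> //; left.
    by apply: nf; left; apply: QA; exists 0, 1; rewrite mul1r add0r.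
  rewrite /good QI; split; last first.
    by move=> t Tt [x [a [Px et]]]; apply: nt; exists t, x, a.
  split.
  - by exists 0, 0; rewrite mul0r addr0.
  - move=> _ _ [x [a [Px ->]]] [y [b [Py ->]]]; exists (x + y), (a + b).
    by split; [exact: PD|ring].
  - move=> b _ [x [a [Px ->]]]; exists (b * x), (b * a).
    by split; [exact: PM|ring].
  - move=> k _ [x [a [Px ->]]]; rewrite raddfD /= mulrC (compM _ _ fd).
    case: leqP => _; last by exists (comp k x), 0; rewrite mul0r; split=> //;
      exact: Ph.
    by exists (comp k x), (comp (k - d) a); rewrite mulrC; split=> //; exact: Ph.
apply: hideal_prime => // d k u v ud vk Puv.
apply: contrapT => /not_orP[nu nv].
have [t [x [a [Tt Px et]]]] := Pmax _ _ ud nu.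
have [s [y [b [Ts Py es]]]] := Pmax _ _ vk nv.
apply: (TA (t * s)); first exact: TM.
rewrite et es (_ : _ * _ = (y + b * v) * x + (a * u * y + (a * b) * (u * v)));
  last by ring.
by apply: (PD); [exact: PM|apply: PD; exact: PM].
Qed.

Lemma irrelevantP f : irrelevant_ideal f <-> f@_0%MM = 0.
Proof.
split=> [[g ->]|f0].
  rewrite raddf_sum big1 // => i _.
  rewrite [LHS]rmorphM /= mcoeffX (_ : (_ == _) = false) ?mulr0 //.
  by apply/eqP => /mnmP/(_ i); rewrite mnm1E mnm0E eqxx.
have irrD (u v : S) : irrelevant_ideal u -> irrelevant_ideal v ->
    irrelevant_ideal (u + v).
  move=> [g ->] [h ->]; exists (fun i => g i + h i).
  by rewrite -big_split; apply: eq_bigr => i _; rewrite mulrDl.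
rewrite [f]mpolyE big_seq; apply: big_ind => // [|m fm].
  by exists (fun=> 0); rewrite big1 // => i _; rewrite mul0r.
have : m != 0%MM by apply: contraTneq fm => ->; rewrite mcoeff_msupp f0 eqxx.
case: (pickP (fun i => m i != 0%N)) => [i mi _|m0]; last first.
  by move=> /eqP[]; apply/mnmP => i; rewrite mnm0E; have /negbFE/eqP := m0 i.
exists (fun j => if j == i then f@_m *: 'X_[m - U_(i)] else 0).
rewrite (bigD1 i) //= eqxx big1 => [|j /negbTE->]; last by rewrite mul0r.
rewrite addr0 -scalerAl -mpolyXD submK //.
by apply/mnm_lepP => j; rewrite mnm1E; case: eqVneq => // <-; rewrite lt0n.
Qed.

Lemma homog_irrelevant d f : (0 < d)%N -> f \is d.-homog -> irrelevant_ideal f.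
Proof.
move=> d0 fd; apply/irrelevantP; apply: dhomog_nemf_coeff fd _.
by rewrite /= mdeg0 ltn_eqF.
Qed.

Lemma dhomogXU i : ('X_i : S) \is 1.-homog.
Proof. by rewrite dhomogX /= mdeg1. Qed.

Lemma dhomogXUn i d : ('X_i ^+ d : S) \is d.-homog.
Proof. by rewrite -[d in d.-homog]mul1n; apply: dhomogMn; exact: dhomogXU. Qed.

Section Point.
Variable p : proj_point F n.
Local Notation P := (pt_ideal p).

Lemma pt_hideal : hideal P.
Proof.
have [p0 _ pD] := pt_ideal_closed p; split.
- exact/set_mem.
- by move=> u v Pu Pv; apply/set_mem; rewrite -[u]mul1r; apply: pD; exact/mem_set.
- by move=> a u Pu; apply/set_mem; rewrite -[_ * _]addr0; apply: pD => //;
    exact/mem_set.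
- exact: pt_ideal_homogeneous.
Qed.

Lemma pt1 : ~ P 1.
Proof. by case: (pt_ideal_closed p) => _ /negP + _ p1; apply; apply/mem_set. Qed.

Lemma ptC (c : F) : c != 0 -> ~ P c%:MP.
Proof.
move=> c0 Pc; apply: pt1; have [_ _ PM _] := pt_hideal.
by have := PM (c^-1)%:MP _ Pc; rewrite -mpolyCM mulVf.
Qed.

Lemma ptMl u v : P v -> P (u * v).
Proof. by case: pt_hideal => _ _ + _; apply. Qed.

Lemma ptMr u v : P u -> P (u * v).
Proof. by rewrite mulrC; exact: ptMl. Qed.

Lemma ptD u v : P u -> P v -> P (u + v).
Proof. by case: pt_hideal => _ + _ _; apply. Qed.

Lemma ptB u v : P u -> P v -> P (u - v).
Proof. by move=> *; apply: hidealB => //; exact: pt_hideal. Qed.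

Lemma pt_prime u v : P (u * v) -> P u \/ P v.
Proof.
by move=> /mem_set/(pt_ideal_prime (p := p))/orP[]/set_mem; [left|right].
Qed.

Lemma pt_prime_exp u d : P (u ^+ d) -> P u.
Proof.
by elim: d => [/pt1//|d IH]; rewrite exprS => /pt_prime[//|/IH].
Qed.

Lemma pt_sub_irrelevant : P `<=` @irrelevant_ideal F n.
Proof.
move=> f Pf; apply/irrelevantP/eqP; apply: contrapT => /negP f0.
by apply: (ptC f0); rewrite -comp0E; have [_ _ _] := pt_hideal; apply.
Qed.

Lemma pt_notX : exists i, ~ P 'X_i.
Proof.
apply: contrapT => /forallNP PX; apply: (@pt_ideal_relevant _ _ p).
apply/seteqP; split=> [|_ [g ->]]; first exact: pt_sub_irrelevant.
apply: hideal_sum => [|i _]; [exact: pt_hideal|apply: ptMl].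
exact: contrapT (PX i).
Qed.

End Point.

Lemma hprime_point (P : set S) : hideal P -> ~ P 1 ->
    (forall u v, P (u * v) -> P u \/ P v) -> P <> @irrelevant_ideal F n ->
  exists p, pt_ideal p = P.
Proof.
move=> [P0 PD PM Ph] P1 Pp Pne.
have Pcl : idealr_closed (mem P).
  split; first exact/mem_set.
    by apply/negP => /set_mem.
  by move=> a v w /set_mem Pv /set_mem Pw; apply/mem_set/PD => //; apply: PM.
have Ppr : prime_idealr_closed (mem P).
  by move=> v w /set_mem/Pp[]/mem_set Pv; apply/orP; [left|right].
by exists (ProjPoint Pcl Ppr Ph Pne).
Qed.

(** The element u of T keeps the prime given by exists_hprime away from the
    irrelevant ideal. *)
Lemma exists_point I T u : hideal I -> irrelevant_ideal u -> T u ->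
    T 1 -> (forall s t, T s -> T t -> T (s * t)) ->
    (forall t, T t -> exists d, t \is d.-homog) ->
    (forall t, T t -> ~ I t) ->
  exists p, I `<=` pt_ideal p /\ forall t, T t -> ~ pt_ideal p t.
Proof.
move=> HI uirr Tu T1 TM Th TI.
have [P [HP IP TP Pp]] := exists_hprime HI T1 TM Th TI.
have [|e|p eP] := hprime_point HP _ Pp; first exact: TP.
  by apply: (TP _ Tu); rewrite e.
by exists p; rewrite eP.
Qed.

(** The Nullstellensatz for homogeneous elements of positive degree. *)
Lemma zero_locus_power I f d : hideal I -> (0 < d)%N -> f \is d.-homog ->
    (forall p, I `<=` pt_ideal p -> pt_ideal p f) ->
  exists k, I (f ^+ k).
Proof.
move=> HI d0 fd If; apply: contrapT => /forallNP nI.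
pose T := [set t | exists k, t = f ^+ k].
have Tf k : T (f ^+ k) by exists k.
have [|||p [Ip pT]] := @exists_point I T f HI (homog_irrelevant d0 fd) (Tf 1%N) (Tf 0%N).
- by move=> _ _ [k ->] [l ->]; rewrite -exprD.
- by move=> _ [k ->]; exists (d * k)%N; exact: dhomogMn.
- by move=> _ [k ->]; exact: nI.
- by apply: (pT _ (Tf 1%N)); rewrite expr1; exact: If.
Qed.

End HomogeneousIdeals.

(** * Regular sequences and their syzygies *)

Section RegularSequences.

Variable R : idomainType.
Implicit Types (y : nat -> R) (k : nat).

Definition regular_seq y k := forall i, (i < k)%N ->
  forall (c : R) (b : nat -> R), y i * c = \sum_(j < i) b j * y j ->
  exists b' : nat -> R, c = \sum_(j < i) b' j * y j.

(** The last coefficient is a combination of the previous elements; moving it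
    over to the other coefficients shortens the relation. *)
Lemma regular_syzygy y k (c : nat -> R) : regular_seq y k ->
    \sum_(i < k) c i * y i = 0 ->
  exists h : nat -> nat -> R, [/\ forall i j, h i j = - h j i,
    forall i, h i i = 0 &
    forall i, (i < k)%N -> c i = \sum_(j < k) h i j * y j].
Proof.
elim: k c => [|k IH] c reg; first by exists (fun _ _ => 0); split=> *; rewrite ?oppr0.
rewrite big_ord_recr /= => c0.
have [|b ck] := reg k (ltnSn k) (c k) (fun j => - c j).
  rewrite mulrC; under eq_bigr do rewrite mulNr.
  by rewrite sumrN; apply/eqP; rewrite -addr_eq0 addrC c0.
have [||h [hN h0 hc]] := IH (fun j => c j + b j * y k).
- by move=> i ik; apply: reg; rewrite ltnS ltnW.
- rewrite -[RHS]c0 ck mulr_suml -big_split /=; apply: eq_bigr => j _.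
  by rewrite mulrDl mulrAC.
exists (fun i j => if (i < k)%N then if (j < k)%N then h i j else - b i
                   else if (j < k)%N then b j else 0).
split=> [i j|i|i].
- by case: (i < k)%N; case: (j < k)%N; rewrite ?opprK ?oppr0.
- by case: (i < k)%N.
rewrite ltnS leq_eqVlt big_ord_recr /= ltnn => /orP[/eqP->|ik].
  by rewrite ltnn ck mul0r addr0; apply: eq_bigr => j _; rewrite ltn_ord.
rewrite ik (eq_bigr (fun j : 'I_k => h i j * y j)) => [|j _].
  by rewrite -hc // mulNr addrK.
by rewrite ltn_ord.
Qed.

Lemma regular_seqW y k l : (k <= l)%N -> regular_seq y l -> regular_seq y k.
Proof. by move=> kl reg i ik; apply: reg; apply: leq_trans kl. Qed.

Lemma regular_iso (phi psi : {rmorphism R -> R}) y k :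
  cancel phi psi -> cancel psi phi -> regular_seq y k -> regular_seq (phi \o y) k.
Proof.
move=> phiK psiK reg i ik c b /= e.
have [|b' e'] := reg i ik (psi c) (psi \o b).
  rewrite -[y i]phiK -rmorphM e rmorph_sum; apply: eq_bigr => j _.
  by rewrite rmorphM phiK.
exists (phi \o b'); rewrite -[c]psiK e' rmorph_sum; apply: eq_bigr => j _.
by rewrite rmorphM.
Qed.

Lemma regular_neq0 y k : regular_seq y k -> (0 < k)%N -> y 0 != 0.
Proof.
move=> reg k0; apply/eqP => y0; have [|b] := reg 0%N k0 1 (fun=> 0).
  by rewrite y0 mul0r big_ord0.
by rewrite big_ord0 => /eqP; rewrite oner_eq0.
Qed.

Section Matrices.
Variables m p : nat.
Local Notation M := 'M[R]_(m, p).

Lemma scalemx_inj (a : R) (A B : M) : a != 0 -> a *: A = a *: B -> A = B.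
Proof.
move=> a0 /matrixP e; apply/matrixP => i j.
by have := e i j; rewrite !mxE; apply: mulfI.
Qed.

(** In the Koszul complex of k + 1 elements the cocycles of degree k are the
    syzygies of these elements, which regularity makes coboundaries. This is
    spelled out for k = 1, 2 and 3. *)
Lemma regular_cocycle1 y (A B : M) : regular_seq y 2 ->
  y 0%N *: B = y 1%N *: A -> exists C, A = y 0%N *: C /\ B = y 1%N *: C.
Proof.
move=> reg e.
suff [C eA] : exists C, A = y 0%N *: C.
  exists C; split=> //; apply: (@scalemx_inj (y 0%N)); first exact: regular_neq0 reg _.
  by rewrite e eA !scalerA mulrC.
have /choice[C HC] : forall ij, exists c, A ij.1 ij.2 = y 0%N * c.
  move=> [i j] /=; have [|b ->] := reg 1%N isT (A i j) (fun=> B i j).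
    by have /matrixP/(_ i j) := e; rewrite !mxE big_ord1 => <-; rewrite mulrC.
  by exists (b 0%N); rewrite big_ord1 mulrC.
by exists (\matrix_(i, j) C (i, j)); apply/matrixP => i j; rewrite !mxE (HC (i, j)).
Qed.

Lemma regular_cocycle2 y (A01 A02 A12 : M) : regular_seq y 3 ->
    y 0%N *: A12 - y 1%N *: A02 + y 2%N *: A01 = 0 ->
  exists C0 C1 C2, [/\ A01 = y 0%N *: C1 - y 1%N *: C0,
    A02 = y 0%N *: C2 - y 2%N *: C0 & A12 = y 1%N *: C2 - y 2%N *: C1].
Proof.
move=> reg e.
have /choice[C HC] : forall ij : 'I_m * 'I_p, exists c : R * R * R,
    [/\ A01 ij.1 ij.2 = y 0%N * c.1.2 - y 1%N * c.1.1,
        A02 ij.1 ij.2 = y 0%N * c.2 - y 2%N * c.1.1 &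
        A12 ij.1 ij.2 = y 1%N * c.2 - y 2%N * c.1.2].
  move=> [i j] /=.
  have [|h [hN h0 he]] := @regular_syzygy _ _
      (nth 0 [:: A12 i j; - A02 i j; A01 i j]) reg.
    rewrite !big_ord_recr big_ord0 /=.
    have /matrixP/(_ i j) := e; rewrite !mxE => e'.
    by rewrite -[RHS]e'; ring.
  have := he 0%N isT; have := he 1%N isT; have := he 2%N isT.
  rewrite !big_ord_recr !big_ord0 /= !h0 !mul0r (hN 1%N 0%N) (hN 2%N 0%N) (hN 2%N 1%N).
  move=> e2 e1 e0; exists (h 1%N 2%N, - h 0%N 2%N, h 0%N 1%N) => /=.
  split; [rewrite e2; ring|rewrite -[LHS]opprK e1; ring|rewrite e0; ring].
exists (\matrix_(i, j) (C (i, j)).1.1), (\matrix_(i, j) (C (i, j)).1.2),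
  (\matrix_(i, j) (C (i, j)).2).
by split; apply/matrixP => i j; rewrite !mxE; have [] := HC (i, j).
Qed.


End Matrices.

Lemma regular_cocycle3 y (c012 c013 c023 c123 : R) : regular_seq y 4 ->
    y 0%N * c123 - y 1%N * c023 + y 2%N * c013 - y 3%N * c012 = 0 ->
  exists d01 d02 d03 d12 d13 d23,
    [/\ c012 = y 0%N * d12 - y 1%N * d02 + y 2%N * d01,
        c013 = y 0%N * d13 - y 1%N * d03 + y 3%N * d01,
        c023 = y 0%N * d23 - y 2%N * d03 + y 3%N * d02 &
        c123 = y 1%N * d23 - y 2%N * d13 + y 3%N * d12].
Proof.
move=> reg e.
have [|h [hN h0 he]] := @regular_syzygy _ _
    (nth 0 [:: c123; - c023; c013; - c012]) reg.
  by rewrite !big_ord_recr big_ord0 /= -[RHS]e; ring.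
have := he 0%N isT; have := he 1%N isT; have := he 2%N isT; have := he 3%N isT.
rewrite !big_ord_recr !big_ord0 /= !h0 !mul0r (hN 1%N 0%N) (hN 2%N 0%N).
rewrite (hN 2%N 1%N) (hN 3%N 0%N) (hN 3%N 1%N) (hN 3%N 2%N) => e3 e2 e1 e0.
exists (h 2%N 3%N), (- h 1%N 3%N), (h 1%N 2%N), (h 0%N 3%N), (- h 0%N 2%N), (h 0%N 1%N).
split; [rewrite -[LHS]opprK e3|rewrite e2|rewrite -[LHS]opprK e1|rewrite e0]; ring.
Qed.

End RegularSequences.

Section MonomialRegular.

Variables (F : fieldType) (n : nat).
Local Notation S := {mpoly F[n]}.

Lemma mcoeffMX_neq0 (p : S) (a m : 'X_{1..n}) :
  (p * 'X_[a])@_m != 0 -> (a <= m)%MM.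
Proof.
rewrite -mcoeff_msupp (perm_mem (msuppMX _ _)) => /mapP[b _ ->].
exact: lem_addr.
Qed.

(** Powers of distinct variables form a regular sequence because membership in
    the ideal that they generate is tested on each monomial separately. *)
Lemma mem_monomial_ideal (s : nat -> 'I_n) (N i : nat) (f : S) :
    (forall m, f@_m != 0 -> exists2 j, (j < i)%N & (N <= m (s j))%N) ->
  exists b : nat -> S, f = \sum_(j < i) b j * 'X_(s j) ^+ N.
Proof.
move=> fs; pose P u := exists b : nat -> S, u = \sum_(j < i) b j * 'X_(s j) ^+ N.
rewrite -/(P f) [f]mpolyE big_seq; apply: big_ind => [|_ _ [b ->] [c ->]|m].
- by exists (fun=> 0); rewrite big1 // => j _; rewrite mul0r.
- exists (fun j => b j + c j).
  by rewrite -big_split; apply: eq_bigr => j _; rewrite mulrDl.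
rewrite mcoeff_msupp => /fs[j ji Nm].
exists (fun k => if k == j then f@_m *: 'X_[m - U_(s j) *+ N] else 0).
rewrite (bigD1 (Ordinal ji)) //= eqxx big1 ?addr0 => [|k]; last first.
  by rewrite -val_eqE /= => /negbTE->; rewrite mul0r.
rewrite -scalerAl mpolyXn -mpolyXD submK //; apply/mnm_lepP => k.
by rewrite mulmnE mnm1E; case: eqVneq => [<-|]; rewrite ?mul1n.
Qed.

Lemma regular_Xn (s : nat -> 'I_n) (N k : nat) :
    {in gtn k &, injective s} ->
  regular_seq (fun j => 'X_(s j) ^+ N : S) k.
Proof.
move=> sinj i ik c b e; apply: mem_monomial_ideal => m cm.
pose m' := (U_(s i) *+ N + m)%MM.
have : (\sum_(j < i) b j * 'X_(s j) ^+ N)@_m' != 0.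
  by rewrite -e mulrC mpolyXn mcoeffMX.
rewrite raddf_sum /=.
have [/existsP[j]|/existsPn j0] := boolP [exists j : 'I_i, (b j * 'X_(s j) ^+ N)@_m' != 0].
  rewrite mpolyXn => /mcoeffMX_neq0/mnm_lepP/(_ (s j)) + _.
  rewrite /m' mnmDE !mulmnE !mnm1E eqxx mul1n.
  have /negbTE-> : s i != s j.
    apply: contraTneq (ltn_ord j) => /sinj; rewrite !inE => <- //.
      by rewrite ltnn.
    exact: ltn_trans ik.
  by move=> jm; exists j.
by rewrite big1 ?eqxx // => j _; apply/eqP/negPn/j0.
Qed.

End MonomialRegular.

(** * Differential forms *)

Section Forms.

Variables (F : fieldType) (n : nat).
Local Notation S := {mpoly F[n.+1]}.
Local Notation comp d f := (pihomog (@mdeg n.+1) d f).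
Implicit Types (w eta : 'rV[S]_n.+1) (theta : 'M[S]_n.+1).

Lemma wedge11_is_linear w : linear (wedge11 w).
Proof. by move=> a eta eta'; apply/matrixP => i j; rewrite !mxE; ring. Qed.

HB.instance Definition _ w := GRing.isLinear.Build S 'rV[S]_n.+1 'M[S]_n.+1 _
  (wedge11 w) (wedge11_is_linear w).

Lemma wedge11_0 w : wedge11 w 0 = 0.
Proof. by rewrite linear0. Qed.

Lemma wedge11D w eta eta' :
  wedge11 w (eta + eta') = wedge11 w eta + wedge11 w eta'.
Proof. by rewrite linearD. Qed.

Lemma wedge11Z w a eta : wedge11 w (a *: eta) = a *: wedge11 w eta.
Proof. by rewrite linearZ. Qed.

Lemma wedge11B w eta eta' :
  wedge11 w (eta - eta') = wedge11 w eta - wedge11 w eta'.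
Proof. by rewrite linearB. Qed.

Lemma wedge11_self w : wedge11 w w = 0.
Proof. by apply/matrixP => i j; rewrite !mxE mulrC subrr. Qed.

(** The product with the row radial_field on the left is the contraction of
    2-forms with the radial vector field. *)
Lemma radial_wedge11 w eta : contraction (radial_field F n) w = 0 ->
  radial_field F n *m wedge11 w eta = - contraction (radial_field F n) eta *: w.
Proof.
move=> w0; apply/rowP => j; rewrite !mxE.
transitivity (contraction (radial_field F n) w * eta 0 j
  - contraction (radial_field F n) eta * w 0 j); last by rewrite w0; ring.
rewrite !mulr_suml -sumrB; apply: eq_bigr => i _; rewrite !mxE; ring.
Qed.

Lemma euler d (f : S) : f \is d.-homog ->
  \sum_(i < n.+1) 'X_i * mderiv i f = d%:R * f.
Proof.
move=> fd; rewrite [f]mpolyE mulr_sumr.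
under eq_bigr do rewrite raddf_sum mulr_sumr /=.
rewrite exchange_big /=; apply: eq_big_seq => m mf.
have md : mdeg m = d by have /dhomogP := fd; apply.
under eq_bigr do rewrite mderivZ mderivX.
rewrite -md mdegE natr_sum mulr_suml; apply: eq_bigr => i _.
rewrite -!scalerAr; congr (_ *: _); rewrite mulr_natl -scaler_nat.
have [->|mi] := posnP (m i); first by rewrite !scale0r.
rewrite -mpolyXD addmC submK //.
by apply/mnm_lepP => k; rewrite mnm1E; case: eqVneq => // <-.
Qed.

Lemma radial_exterior_d d w : (forall i, w 0 i \is d.-homog) ->
    contraction (radial_field F n) w = 0 ->
  radial_field F n *m exterior_d w = d.+1%:R *: w.
Proof.
move=> wd w0; apply/rowP => j; rewrite !mxE.
transitivity (\sum_i 'X_i * mderiv i (w 0 j)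
  - (mderiv j (contraction (radial_field F n) w) - w 0 j)).
  rewrite raddf_sum /=.
  rewrite [X in _ - (X - _)](eq_bigr (fun i =>
    'X_i * mderiv j (w 0 i) + (i == j)%:R * w 0 i)) => [|i _]; last first.
    rewrite mxE mderivM mderivX mnm1E addrC; congr (_ + _ * _).
    case: eqVneq => [->|_]; last by rewrite scale0r.
    rewrite scale1r (_ : (_ - _)%MM = 0%MM) ?mpolyX0 //.
    by apply/mnmP => k; rewrite mnmBE subnn mnm0E.
  rewrite big_split /= [X in _ - (_ + X - _)](bigD1 j) //= eqxx mul1r.
  rewrite [X in _ - (_ + (_ + X) - _)]big1 => [|i /negbTE->]; last by rewrite mul0r.
  rewrite addr0 addrK -sumrB; apply: eq_bigr => i _; rewrite !mxE; ring.
by rewrite (euler (wd j)) w0 raddf0; ring.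
Qed.

Lemma map_comp_wedge11 d k w eta : (forall i, w 0 i \is d.-homog) ->
  map_mx (pihomog (@mdeg n.+1) k) (wedge11 w eta) =
  if (d <= k)%N then wedge11 w (map_mx (pihomog (@mdeg n.+1) (k - d)) eta) else 0.
Proof.
move=> wd; apply/matrixP => i j.
rewrite !mxE raddfB /= !(compM _ _ (wd _)).
by case: ifP; rewrite !mxE ?subrr.
Qed.

Lemma exterior_d_homog d w i j : (forall i, w 0 i \is d.-homog) ->
  exterior_d w i j \is d.-1.-homog.
Proof.
move=> wd; have dh (k l : 'I_n.+1) : mderiv k (w 0 l) \is d.-1.-homog.
  rewrite [w 0 l]mpolyE raddf_sum /= big_seq rpred_sum // => m mw.
  rewrite mderivZ mderivX rpredZ //.
  have md : mdeg m = d by have /dhomogP := wd l; apply.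
  have [->|mk] := posnP (m k); first by rewrite scale0r rpred0.
  rewrite rpredZ // dhomogX /= -md.
  have Um : (U_(k) <= m)%MM.
    by apply/mnm_lepP => x; rewrite mnm1E; case: eqVneq => // <-.
  by have := mdegD (m - U_(k)) U_(k); rewrite submK // mdeg1 addn1 => ->.
by rewrite mxE rpredB.
Qed.

Lemma ideal_J0 w : ideal_J w 0.
Proof. by exists 0; rewrite /contraction big1 // => i _; rewrite mxE mul0r. Qed.

Lemma ideal_JD w f g : ideal_J w f -> ideal_J w g -> ideal_J w (f + g).
Proof.
move=> [X ->] [Y ->]; exists (X + Y); rewrite /contraction -big_split.
by apply: eq_bigr => i _; rewrite mxE mulrDl.
Qed.

Lemma ideal_JM w a f : ideal_J w f -> ideal_J w (a * f).
Proof.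
move=> [X ->]; exists (a *: X); rewrite /contraction mulr_sumr.
by apply: eq_bigr => i _; rewrite mxE mulrA.
Qed.

Lemma ideal_JP w i : ideal_J w (w 0 i).
Proof.
exists (\row_j (j == i)%:R); rewrite /contraction (bigD1 i) //= big1 => [|j].
  by rewrite mxE eqxx mul1r addr0.
by move=> /negbTE ji; rewrite mxE ji mul0r.
Qed.

(** A common prime factor f of the coefficients of w would give a point of
    height one in the singular locus: the ideal of the polynomials all of whose
    components are multiples of f. *)
Lemma no_common_prime d w (f : S) :
    (0 < n)%N -> (forall i, w 0 i \is d.-homog) ->
  codim_ge 2 (sing w) -> prime_elt f -> ~ forall i, divides f (w 0 i).
Proof.
move=> n0 wd cod pf fw; have [f0 fu fdiv] := pf.
have fD u v : divides f u -> divides f v -> divides f (u + v).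
  by move=> [a ->] [b ->]; exists (a + b); ring.
have fM a u : divides f u -> divides f (a * u).
  by move=> [b ->]; exists (a * b); ring.
have fz : divides f 0 by exists 0; rewrite mul0r.
pose P : set S := [set u | forall k, divides f (comp k u)].
have PE k u : u \is k.-homog -> P u <-> divides f u.
  move=> uk; split=> [/(_ k)|fu' l]; first by rewrite pihomog_dE.
  have [->|kl] := eqVneq l k; first by rewrite pihomog_dE.
  by rewrite (@pihomog_ne0 _ _ _ k) // eq_sym.
have subP u : P u -> divides f u.
  by move=> Pu; rewrite [u]comp_sum; apply: big_ind.
have HP : hideal P.
  split.
  - by move=> k; rewrite raddf0.
  - by move=> u v Pu Pv k; rewrite pihomogD; exact: fD (Pu k) (Pv k).
  - move=> a u Pu k; rewrite [a]comp_sum mulr_suml raddf_sum.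
    apply: big_ind => // i _; rewrite /= (compM _ _ (pihomogP _ _ _)).
    by case: ifP => _ //; exact: fM (Pu _).
  - by move=> k u Pu; apply/(PE k); [exact: pihomogP|exact: Pu].
have P1 : ~ P 1.
  move=> /subP[c /esym e]; move/negP: fu; apply.
  by apply/unitrPr; exists c; rewrite mulrC.
have Pprime : forall u v, P (u * v) -> P u \/ P v.
  apply: hideal_prime => // k l u v uk vl.
  by rewrite (PE _ _ (dhomogM uk vl)) (PE _ _ uk) (PE _ _ vl); exact: fdiv.
have Pne : P <> @irrelevant_ideal F n.
  move=> e; have fX i : divides f 'X_i.
    by apply: subP; rewrite e; apply: homog_irrelevant (dhomogXU _ i).
  have [c ec] := fX (inord 0); have [c' ec'] := fX (inord 1).
  have reg : regular_seq (fun j => 'X_(inord j) ^+ 1 : S) 2.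
    apply: regular_Xn => i j; rewrite !inE => i2 j2 /(congr1 val).
    by rewrite /= !inordK // ltnS ?(leq_trans _ n0).
  have [|b eb] := reg 1%N isT c (fun=> c').
    by apply: (mulIf f0); rewrite big_ord1 !expr1 -mulrA -ec mulrAC -ec' mulrC.
  move/negP: fu; apply; apply/unitrPr; exists (b 0%N).
  have X0 : ('X_(inord 0) : S) != 0 by rewrite -msupp_eq0 msuppX.
  apply: (mulIf X0); rewrite mul1r {2}ec eb big_ord1 expr1; ring.
have [p eP] := hprime_point HP P1 Pprime Pne.
have [|q [q2 qlt]] := cod p.
  move=> _ [X ->]; rewrite eP; suff : P (contraction X w) by apply.
  have [_ _ PM _] := HP.
  by apply: hideal_sum => // i _; apply: PM; apply/(PE _ _ (wd i)).
have [q01 /existsNP[g /not_implyP[qg nqg]]] := qlt 0%N isT.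
have g0 : g != 0.
  by apply/eqP => e; apply: nqg; rewrite e; case: (pt_hideal (q 0%N)).
have [q12 nq] := qlt 1%N isT; apply: nq; rewrite q2 eP.
(* f lies in any nonzero prime contained in (f). *)
suff Qprime (Q : proj_point F n) (u : S) : pt_ideal Q `<=` P -> u != 0 ->
    pt_ideal Q u -> pt_ideal Q f.
  have Qf : pt_ideal (q 1%N) f.
    by apply: Qprime g0 qg => u /q12; rewrite q2 eP.
  by move=> u /subP[c ->]; exact: ptMl.
move=> QP; have [m] := ubnP (msize u); elim: m u => // m IH u; rewrite ltnS.
move=> um u0 Qu; have [c ec] := subP _ (QP _ Qu).
have c0 : c != 0 by apply: contraNneq u0; rewrite ec => ->; rewrite mul0r.
move: (Qu); rewrite ec => /pt_prime[Qc|//]; apply: IH (c0) Qc.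
apply: leq_trans um; rewrite ec msizeM //.
have : (1 < msize f)%N.
  rewrite ltnNge; apply/negP => /msize1_polyC ef.
  move/negP: fu; apply; apply/unitrPr; exists (f@_0%MM)^-1%:MP.
  rewrite {1}ef -mpolyCM mulfV //.
  by apply: contraNneq f0 => e; rewrite ef e.
by case: (msize f) => [|[|k]] // _; rewrite !addnS /= ltnS leq_addr.
Qed.

(** A nonzero coefficient of w is divided out of the same coefficient of eta one
    prime factor at a time, as no prime divides all the coefficients of w. So the
    complex S -> Omega^1 -> Omega^2 of exterior multiplication by w is exact in
    the middle. *)
Lemma wedge11_eq0 d w eta : (0 < n)%N -> (forall i, w 0 i \is d.-homog) ->
    w != 0 -> codim_ge 2 (sing w) -> wedge11 w eta = 0 ->
  exists g, eta = g *: w.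
Proof.
move=> n0 wd w0 cod we.
have ew i j : eta 0 i * w 0 j = eta 0 j * w 0 i.
  have /matrixP/(_ i j) := we; rewrite !mxE => /eqP.
  by rewrite subr_eq0 => /eqP e; rewrite mulrC -e mulrC.
have [i wi] := rV0Pn _ w0.
suff div (y : S) : y != 0 -> forall x : S, (forall j, divides y (x * w 0 j)) ->
    divides y x.
  have [|g eg] := div _ wi (eta 0 i); first by move=> j; rewrite ew; exists (eta 0 j).
  exists g; apply/rowP => j; rewrite !mxE; apply: (mulIf wi).
  by rewrite -ew eg; ring.
move: y; apply: (factorial_ind (@factorial_mpoly F n.+1)).
  by move=> u uu x _; exists (x * u^-1); rewrite mulrVK.
move=> p y pp y0 IH x px.
have [p0 _ pdiv] := pp.
have [j npj] : exists j, ~ divides p (w 0 j).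
  by apply/existsNP; exact: no_common_prime wd cod pp.
have [|[x' ex]|//] := pdiv x (w 0 j).
  by have [c ->] := px j; exists (c * y); ring.
have [|c ec] := IH x'; last by exists c; rewrite ex ec; ring.
move=> k; have [c ec] := px k; exists c; apply: (mulfI p0).
by transitivity (x * w 0 k); [rewrite ex|rewrite ec]; ring.
Qed.

End Forms.

(** * Depth of the cokernel of a linear map of free modules *)

(** The hypotheses say that S -> S^k -> M_(l, l') is exact, the first map being
    the multiplication of w by scalars and the second one L; so the cokernel of L
    has projective dimension at most two. The lemmas below are the resulting
    statements on its depth, obtained by chasing Koszul cochains. *)
Section Depth.

Variables (S : idomainType) (k l l' : nat).
Variables (L : {linear 'rV[S]_k -> 'M[S]_(l, l')}) (w : 'rV[S]_k).
Hypothesis w0 : w != 0.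
Hypothesis Lw : L w = 0.
Hypothesis exact : forall eta, L eta = 0 -> exists g, eta = g *: w.

Let LZ a eta : L (a *: eta) = a *: L eta.
Proof. by rewrite linearZ. Qed.

Let LB eta eta' : L (eta - eta') = L eta - L eta'.
Proof. by rewrite linearB. Qed.

Let exact_coef eta : L eta = 0 ->
  exists g, forall i, eta 0 i = g * w 0 i.
Proof. by move=> /exact[g ->]; exists g => i; rewrite mxE. Qed.

(** The quotients of theta by the y_i, in S^k, are determined up to multiples of
    w; they differ by a Koszul cocycle with values in S w, which is a coboundary.
    So no nonzero element of the cokernel is killed by three regular elements. *)
Lemma coker_depth1 (y : nat -> S) (theta : 'M_(l, l')) : regular_seq y 3 ->
    (forall i, (i < 3)%N -> exists eta, y i *: theta = L eta) ->
  exists zeta, theta = L zeta.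
Proof.
move=> reg thy.
have [h0 e0] := thy 0%N isT; have [h1 e1] := thy 1%N isT.
have [h2 e2] := thy 2%N isT.
have diff a b (r s : 'rV_k) : a *: theta = L r ->
    b *: theta = L s -> L (a *: s - b *: r) = 0.
  by move=> er es; rewrite LB !LZ -er -es !scalerA mulrC subrr.
have [g01 E01] := exact_coef (diff _ _ _ _ e0 e1).
have [g02 E02] := exact_coef (diff _ _ _ _ e0 e2).
have [g12 E12] := exact_coef (diff _ _ _ _ e1 e2).
have [|c0 [c1 [c2 [H01 H02 H12]]]] :=
    @regular_cocycle2 _ 1 1 y g01%:M g02%:M g12%:M reg.
  apply/matrixP => a b; rewrite !ord1 !mxE /= !mulr1n.
  have [i wi] := rV0Pn _ w0; apply: (mulIf wi); rewrite mul0r.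
  have := E01 i; have := E02 i; have := E12 i; rewrite !mxE => E12' E02' E01'.
  transitivity (y 0%N * (g12 * w 0 i) - y 1%N * (g02 * w 0 i)
    + y 2%N * (g01 * w 0 i)); first by ring.
  by rewrite -E12' -E02' -E01'; ring.
have [||c [Hc _]] := @regular_cocycle1 _ 1 k y
    (h0 - c0 0 0 *: w) (h1 - c1 0 0 *: w).
- exact: regular_seqW reg.
- apply/rowP => i; have := E01 i; have /matrixP/(_ 0 0) := H01.
  rewrite !mxE /= !mulr1n => -> E; apply/eqP; rewrite -subr_eq0; apply/eqP.
  transitivity (y 0%N * h1 0 i - y 1%N * h0 0 i
    - (y 0%N * c1 0 0 - y 1%N * c0 0 0) * w 0 i); first by ring.
  by rewrite -E; ring.
exists c; apply: (@scalemx_inj _ _ _ (y 0%N)); first exact: regular_neq0 reg _.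
by rewrite e0 -LZ -Hc LB LZ Lw scaler0 subr0.
Qed.

(** The vanishing of the first local cohomology of the cokernel: a Koszul
    cocycle m of degree one is a coboundary. The obstructions are successively a
    cocycle of degree two in S^k and one of degree three in S. *)
Lemma coker_depth2 (y : nat -> S) (m : nat -> 'M[S]_(l, l')) : regular_seq y 4 ->
    (forall i j, exists eta, y i *: m j - y j *: m i = L eta) ->
  exists theta, forall j, (j < 4)%N ->
    exists zeta, m j - y j *: theta = L zeta.
Proof.
move=> reg my.
have [h01 e01] := my 0%N 1%N; have [h02 e02] := my 0%N 2%N.
have [h03 e03] := my 0%N 3%N; have [h12 e12] := my 1%N 2%N.
have [h13 e13] := my 1%N 3%N; have [h23 e23] := my 2%N 3%N.
have diff i j h (r s t : 'rV_k) :
    y i *: m j - y j *: m i = L r ->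
    y i *: m h - y h *: m i = L s ->
    y j *: m h - y h *: m j = L t ->
    L (y i *: t - y j *: s + y h *: r) = 0.
  move=> er es et; rewrite linearD LB !LZ -er -es -et.
  move: (y i) (y j) (y h) (m i) (m j) (m h) => a b c A B C.
  by apply/matrixP => u v; rewrite !mxE; ring.
have [g012 E012] := exact_coef (diff _ _ _ _ _ _ e01 e02 e12).
have [g013 E013] := exact_coef (diff _ _ _ _ _ _ e01 e03 e13).
have [g023 E023] := exact_coef (diff _ _ _ _ _ _ e02 e03 e23).
have [g123 E123] := exact_coef (diff _ _ _ _ _ _ e12 e13 e23).
have [|d01 [d02 [d03 [d12 [d13 [d23 [D012 D013 D023 D123]]]]]]] :=
    @regular_cocycle3 _ y g012 g013 g023 g123 reg.
  have [i wi] := rV0Pn _ w0; apply: (mulIf wi); rewrite mul0r.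
  have := E012 i; have := E013 i; have := E023 i; have := E123 i.
  rewrite !mxE => E1 E2 E3 E4.
  transitivity (y 0%N * (g123 * w 0 i) - y 1%N * (g023 * w 0 i)
    + y 2%N * (g013 * w 0 i) - y 3%N * (g012 * w 0 i)); first by ring.
  by rewrite -E1 -E2 -E3 -E4; ring.
have reduced i j h (r s t : 'rV_k) dij dik djk g :
    (forall x, (y i *: t - y j *: s + y h *: r) 0 x = g * w 0 x) ->
    g = y i * djk - y j * dik + y h * dij ->
    y i *: (t - djk *: w) - y j *: (s - dik *: w) + y h *: (r - dij *: w) = 0.
  move=> E eg; apply/rowP => x; have := E x; rewrite eg !mxE => E'.
  transitivity (y i * t 0 x - y j * s 0 x + y h * r 0 x
    - (y i * djk - y j * dik + y h * dij) * w 0 x); first by ring.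
  by rewrite -E'; ring.
have R012 := reduced _ _ _ _ _ _ _ _ _ _ E012 D012.
have R013 := reduced _ _ _ _ _ _ _ _ _ _ E013 D013.
have R023 := reduced _ _ _ _ _ _ _ _ _ _ E023 D023.
set k01 := h01 - _ in R012 R013; set k02 := h02 - _ in R012 R023.
set k12 := h12 - _ in R012; set k03 := h03 - _ in R013 R023.
set k13 := h13 - _ in R013; set k23 := h23 - _ in R023.
have wk h a : L (h - a *: w) = L h.
  by rewrite LB LZ Lw scaler0 subr0.
have y0 : y 0%N != 0 by exact: regular_neq0 reg _.
have [|z0 [z1 [z2 [Z01 Z02 _]]]] := regular_cocycle2 _ R012.
  exact: regular_seqW reg.
have [||z3 [Z03 _]] := @regular_cocycle1 _ _ _ y (k03 + y 3%N *: z0) (k13 + y 3%N *: z1).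
- exact: regular_seqW reg.
- apply/rowP => x; have /matrixP/(_ 0 x) := R013; rewrite Z01 !mxE => E.
  by apply/eqP; rewrite -subr_eq0; apply/eqP; rewrite -[RHS]E; ring.
have [||theta [T0 T1]] := @regular_cocycle1 _ _ _ y (m 0%N - L z0)
    (m 1%N - L z1).
- exact: regular_seqW reg.
- apply/eqP; rewrite -subr_eq0; apply/eqP.
  transitivity (y 0%N *: m 1%N - y 1%N *: m 0%N
    - L (y 0%N *: z1 - y 1%N *: z0)).
    by rewrite LB !LZ; apply/matrixP => a b; rewrite !mxE; ring.
  by rewrite e01 -(wk h01 d01) -/k01 Z01 subrr.
exists theta => -[|[|[|[|]]]] // _.
- by exists z0; rewrite -T0 opprB addrC subrK.
- by exists z1; rewrite -T1 opprB addrC subrK.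
- exists z2; apply: (scalemx_inj y0); apply/eqP; rewrite -subr_eq0; apply/eqP.
  transitivity (y 0%N *: m 2%N - y 2%N *: m 0%N
    + y 2%N *: (m 0%N - L z0 - y 0%N *: theta)
    - L (y 0%N *: z2 - y 2%N *: z0)).
    by rewrite LB !LZ; apply/matrixP => a b; rewrite !mxE; ring.
  by rewrite T0 subrr scaler0 addr0 e02 -(wk h02 d02) -/k02 Z02 subrr.
- exists z3; apply: (scalemx_inj y0); apply/eqP; rewrite -subr_eq0; apply/eqP.
  transitivity (y 0%N *: m 3%N - y 3%N *: m 0%N
    + y 3%N *: (m 0%N - L z0 - y 0%N *: theta)
    - L (y 0%N *: z3 - y 3%N *: z0)).
    by rewrite LB !LZ; apply/matrixP => a b; rewrite !mxE; ring.
  rewrite T0 subrr scaler0 addr0 e03 -(wk h03 d03) -/k03 -Z03 addrK.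
  by rewrite subrr.
Qed.

End Depth.

(** * Regular functions on an irreducible closed subset *)

Section RegularFunctions.

Variables (F : closedFieldType) (n : nat).
Local Notation S := {mpoly F[n.+1]}.

Lemma monomial_basis D : exists k (v : 'I_k.+1 -> 'X_{1..n.+1}),
  (forall t, mdeg (v t) = D) /\ forall f : S, f \is D.-homog ->
    exists b : 'I_k.+1 -> F, f = \sum_t b t *: 'X_[v t].
Proof.
pose r := [seq m <- [seq bmnm m | m <- enum {: 'X_{1..n.+1 < D.+1}}] | mdeg m == D].
have memr m : (m \in r) = (mdeg m == D).
  rewrite mem_filter; case: eqP => //= mD.
  have mD1 : (mdeg m < D.+1)%N by rewrite mD.
  by apply/mapP; exists (BMultinom mD1); rewrite ?mem_enum.
have sr : (0 < size r)%N.
  case: r memr => [|//] /(_ (U_(ord0) *+ D)%MM).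
  by rewrite mdegMn mdeg1 mul1n eqxx.
exists (size r).-1, (fun t => nth 0%MM r t); split=> [t|f fD].
  by apply/eqP; rewrite -memr mem_nth // -[X in (_ < X)%N](prednK sr).
exists (fun t => f@_(nth 0%MM r t)).
transitivity (\sum_(m <- r) f@_m *: 'X_[m]).
  rewrite {1}[f]mpolyE [in RHS](bigID (mem (msupp f))) /= [X in _ = _ + X]big1.
    rewrite addr0 -[RHS]big_filter; apply: perm_big; apply: uniq_perm; rewrite ?msupp_uniq //.
      by rewrite !filter_uniq // map_inj_uniq ?enum_uniq //; exact: val_inj.
    move=> m; rewrite mem_filter memr andbC; case mf: (m \in msupp f) => //=.
      by have /dhomogP/(_ m mf) /= -> := fD; rewrite eqxx.
    by rewrite andbF.
  by move=> m /memN_msupp_eq0->; rewrite scale0r.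
by rewrite (big_nth 0%MM) big_mkord (prednK sr).
Qed.

(** Global regular functions on the integral closed subset with generic point p
    are constant: multiplication by such a function preserves the polynomials of
    one large degree, modulo p, and the characteristic polynomial of the matrix
    of this operation is a product of linear factors. *)
Lemma regular_function_constant (p : proj_point F n) N (u : 'I_n.+1 -> S) i0 :
    (forall i, u i \is N.-homog) ->
    (forall i k, pt_ideal p ('X_k ^+ N * u i - 'X_i ^+ N * u k)) ->
    ~ pt_ideal p 'X_i0 ->
  exists lambda : F, pt_ideal p (u i0 - lambda *: 'X_i0 ^+ N).
Proof.
move=> uN glue nX; set beta := 'X_i0 ^+ N.
pose D := (n.+1 * N)%N.
have [k [v [vD vspan]]] := monomial_basis D.
have [B HB] : exists B : 'M[F]_k.+1, forall t,
    pt_ideal p (u i0 * 'X_[v t] - beta * \sum_s B t s *: 'X_[v s]).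
  have /choice[b Hb] : forall t, exists b : 'I_k.+1 -> F,
      pt_ideal p (u i0 * 'X_[v t] - beta * \sum_s b s *: 'X_[v s]).
    move=> t; have [i Ni] : exists i, (N <= v t i)%N.
      apply: contrapT => /forallNP lt; have := vD t; rewrite mdegE => e.
      have : (\sum_i (v t i).+1 <= \sum_(i < n.+1) N)%N.
        by apply: leq_sum => i _; rewrite ltnNge; apply/negP; exact: lt.
      rewrite sum_nat_const card_ord -/D -e.
      under eq_bigr do rewrite -addn1.
      by rewrite big_split /= sum_nat_const card_ord -[X in (_ <= X)%N]addn0 leq_add2l.
    have le : (U_(i) *+ N <= v t)%MM.
      apply/mnm_lepP => j; rewrite mulmnE mnm1E.
      by case: eqVneq => [<-|]; rewrite ?mul1n.
    have ev : v t = (v t - U_(i) *+ N + U_(i) *+ N)%MM by rewrite submK.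
    have hom : 'X_[v t - U_(i) *+ N] * u i \is D.-homog.
      rewrite -(vD t) {2}ev mdegD mdegMn mdeg1 mul1n; apply: dhomogM => //.
      by rewrite dhomogX.
    have [b eb] := vspan _ hom; exists b; rewrite -eb.
    rewrite {1}ev mpolyXD -mpolyXn /beta.
    rewrite (_ : _ - _ = 'X_[v t - U_(i) *+ N] *
      ('X_i ^+ N * u i0 - 'X_i0 ^+ N * u i)); last by ring.
    exact: ptMl.
  by exists (\matrix_(t, s) b t s) => t; under eq_bigr do rewrite mxE.
(* B acts on the column of monomials as multiplication by u / beta. *)
pose act (C : 'M[F]_k.+1) t : S := \sum_s C t s *: 'X_[v s].
have actB C t : pt_ideal p (u i0 * act C t - beta * act (C *m B) t).
  rewrite (_ : _ - _ = \sum_s C t s *: (u i0 * 'X_[v s]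
      - beta * \sum_r B s r *: 'X_[v r])).
    apply: hideal_sum => [|s _]; first exact: pt_hideal.
    by rewrite -mul_mpolyC; apply: ptMl.
  have -> : act (C *m B) t = \sum_s C t s *: \sum_r B s r *: 'X_[v r].
    rewrite /act; under [RHS]eq_bigr do rewrite scaler_sumr.
    rewrite exchange_big /=; apply: eq_bigr => r _; rewrite mxE scaler_suml.
    by apply: eq_bigr => s _; rewrite scalerA.
  rewrite /act !mulr_sumr -sumrB; apply: eq_bigr => s _.
  by rewrite scalerBr !scalerAr.
have prodB (s : seq F) C t : pt_ideal p (\prod_(z <- s) (u i0 - z *: beta) * act C t
    - beta ^+ size s * act (C *m \prod_(z <- s) (B - z%:M)) t).
  elim: s C => [|z s IH] C.
    rewrite !big_nil mulmx1 /= expr0 !mul1r subrr.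
    by case: (pt_hideal p).
  have IHz := IH (C *m (B - z%:M)).
  rewrite !big_cons -[X in _ *m X]/((B - z%:M) *m _) mulmxA /=.
  move: (\prod_(x <- s) (u i0 - x *: beta)) (_ *m _ *m _) IHz => Q C' IHz.
  rewrite (_ : _ - _ = Q * (u i0 * act C t - beta * act (C *m B) t)
    + beta * (Q * act (C *m (B - z%:M)) t - beta ^+ size s * act C' t)).
    by apply: ptD; apply: ptMl.
  have -> : act (C *m (B - z%:M)) t = act (C *m B) t - z *: act C t.
    rewrite /act mulmxBr mul_mx_scalar scaler_sumr -sumrB; apply: eq_bigr => x _.
    by rewrite !mxE scalerBl scalerA.
  rewrite exprS -!mul_mpolyC; ring.
have [r er] := closed_field_poly_normal (char_poly B).
have rB : \prod_(z <- r) (B - z%:M) = 0.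
  rewrite -(Cayley_Hamilton B) er (monicP (char_poly_monic B)) scale1r.
  rewrite rmorph_prod; apply: eq_bigr => z _.
  by rewrite rmorphB /= horner_mx_X horner_mx_C.
have vi0 : exists b : 'I_k.+1 -> F, 'X_i0 ^+ D = \sum_t b t *: 'X_[v t].
  by apply: vspan; exact: dhomogXUn.
have [z zr pz] : exists2 z, z \in r & pt_ideal p (u i0 - z *: beta).
  have : pt_ideal p (\prod_(z <- r) (u i0 - z *: beta)).
    have [b eb] := vi0.
    have : pt_ideal p (\prod_(z <- r) (u i0 - z *: beta) * 'X_i0 ^+ D).
      rewrite eb mulr_sumr; apply: hideal_sum => [|t _]; first exact: pt_hideal.
      rewrite -scalerAr -mul_mpolyC; apply: ptMl.
      have := prodB r 1%:M t; rewrite rB mulmx0.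
      have -> : act 0 t = 0 by rewrite /act big1 // => x _; rewrite mxE scale0r.
      have -> : act 1%:M t = 'X_[v t].
        rewrite /act (bigD1 t) //= mxE eqxx scale1r big1 ?addr0 // => x.
        by rewrite mxE eq_sym => /negbTE->; rewrite scale0r.
      by rewrite mulr0 subr0.
    by move=> /pt_prime[//|/pt_prime_exp/nX].
  elim: (r) => [|z s IH]; first by rewrite big_nil => /pt1.
  rewrite big_cons => /pt_prime[pz|/IH[x xs px]]; first by exists z; rewrite ?mem_head.
  by exists x => //; rewrite inE xs orbT.
by exists z.
Qed.

End RegularFunctions.

(** * Linear points and the residues of divisible two-forms *)

Section LinearPoints.

Variables (F : fieldType) (n : nat).
Local Notation S := {mpoly F[n.+1]}.
Implicit Types (p q : proj_point F n) (mu : 'I_n.+1 -> F).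

(** Over an algebraically closed field these are the closed points. *)
Definition linear_point p :=
  exists k mu, forall j, pt_ideal p ('X_j - mu j *: 'X_k).

(** The change of coordinates that turns the variables other than X_k into the
    equations of a linear point. *)
Definition shear k mu : n.+1.-tuple S :=
  [tuple if j == k then 'X_k else 'X_j - mu j *: 'X_k | j < n.+1].

Lemma shearX k mu j :
  'X_j \mPo shear k mu = if j == k then 'X_k else 'X_j - mu j *: 'X_k.
Proof. by rewrite comp_mpolyXU -tnth_nth tnth_mktuple. Qed.

Lemma shearK k mu :
  cancel (comp_mpoly (shear k mu)) (comp_mpoly (shear k (fun j => - mu j))).
Proof.
have fixX j : ('X_j \mPo shear k mu) \mPo shear k (fun j => - mu j) = 'X_j.
  rewrite shearX; case: (eqVneq j k) => [->|jk]; first by rewrite shearX eqxx.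
  rewrite raddfB /= comp_mpolyZ !shearX eqxx (negbTE jk).
  by rewrite scaleNr opprK addrK.
pose phi : {rmorphism S -> S} := comp_mpoly (shear k mu).
pose psi : {rmorphism S -> S} := comp_mpoly (shear k (fun j => - mu j)).
apply: (@mpoly_rmorph_id _ _ (psi \o phi)) => [c|j] /=; last exact: fixX.
by rewrite !comp_mpolyC.
Qed.

Lemma regular_shear k mu (s : nat -> 'I_n.+1) N l :
    {in gtn l &, injective s} ->
  regular_seq (fun a => ('X_(s a) \mPo shear k mu) ^+ N) l.
Proof.
move=> sinj.
have muNN : mu = (fun j => - - mu j) by apply/funext => j; rewrite opprK.
have sK := shearK k mu; have := shearK k (fun j => - mu j); rewrite -muNN => sK'.
have -> : (fun a => ('X_(s a) \mPo shear k mu) ^+ N) =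
    comp_mpoly (shear k mu) \o (fun a => 'X_(s a) ^+ N).
  by apply/funext => a /=; rewrite rmorphXn.
pose phi : {rmorphism S -> S} := comp_mpoly (shear k mu).
pose psi : {rmorphism S -> S} := comp_mpoly (shear k (fun j => - mu j)).
have := @regular_Xn F n.+1 s N l sinj.
by move/(@regular_iso _ phi psi (fun a => 'X_(s a) ^+ N) l sK sK').
Qed.

(** Linear points are closed, so that one of them specializes to another only if
    the two are equal. *)
Lemma sub_linear_point p q k mu : pt_ideal p `<=` pt_ideal q ->
    (forall j, pt_ideal q ('X_j - mu j *: 'X_k)) -> linear_point p ->
  forall j, pt_ideal p ('X_j - mu j *: 'X_k).
Proof.
move=> pq qmu [l [nu pnu]] j.
have nq : ~ pt_ideal q 'X_k.
  move=> qX; have [i nXi] := pt_notX q; apply: nXi.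
  rewrite -[X in pt_ideal q X](subrK (mu i *: 'X_k)); apply: ptD => //.
  by rewrite -mul_mpolyC; apply: ptMl.
have nuk : nu k != 0.
  apply/eqP => e; apply/nq/pq.
  by have := pnu k; rewrite e scale0r subr0.
have pj i : pt_ideal p ('X_i - (nu i / nu k) *: 'X_k).
  rewrite (_ : _ - _ = ('X_i - nu i *: 'X_l)
    - (nu i / nu k)%:MP * ('X_k - nu k *: 'X_l)).
    by apply: ptB; last apply: ptMl.
  rewrite mulrBr !mul_mpolyC scalerA divfK // opprB addrA subrK //.
have -> : mu j = nu j / nu k; last exact: pj.
apply/eqP/negPn/negP; rewrite -subr_eq0 => ne.
have : pt_ideal q ((nu j / nu k - mu j)%:MP * 'X_k).
  rewrite mpolyCB mulrBl !mul_mpolyC.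
  rewrite (_ : _ - _ = ('X_j - mu j *: 'X_k) - ('X_j - (nu j / nu k) *: 'X_k)).
    by apply: ptB => //; apply: pq.
  by rewrite opprB [RHS]addrC addrA subrK.
case/pt_prime => //; apply: ptC.
by rewrite -opprB oppr_eq0.
Qed.

End LinearPoints.

Section Residue.

Variables (F : closedFieldType) (n : nat).
Local Notation S := {mpoly F[n.+1]}.
Local Notation comp d f := (pihomog (@mdeg n.+1) d f).
Variable w : 'rV[S]_n.+1.
Hypothesis w0 : w != 0.
Hypothesis exact : forall eta, wedge11 w eta = 0 -> exists g, eta = g *: w.
Hypothesis radial0 : contraction (radial_field F n) w = 0.

Lemma scalew_inj (a b : S) : a *: w = b *: w -> a = b.
Proof.
move=> e; apply: contrapT => /eqP ab; move/eqP: w0; apply; apply/rowP => i.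
have /rowP/(_ i) := e; rewrite !mxE => /eqP.
by rewrite -subr_eq0 -mulrBl mulf_eq0 subr_eq0 (negbTE ab) => /eqP.
Qed.

(** If theta = w /\ sigma near the closed subset of p, with w vanishing on it,
    then sigma restricts to a row of sections of O(-1), whose contraction with
    the radial field is the constant - c. Times a linear form such sections are
    constants, so that c = 0 unless the linear forms are all proportional. *)
Lemma residue_linear_point (p : proj_point F n) (theta : 'M[S]_n.+1)
    (f : 'I_n.+1 -> S) (sigma : 'I_n.+1 -> 'rV[S]_n.+1) N (c : S) :
    (forall i, pt_ideal p (w 0 i)) ->
    (forall i, f i *: theta = wedge11 w (sigma i)) ->
    (forall i, f i \is N.+1.-homog) ->
    (forall i, pt_ideal p (f i - 'X_i ^+ N.+1)) ->
    radial_field F n *m theta = c *: w -> c@_0%MM != 0 ->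
  linear_point p.
Proof.
move=> pw fth fN pf ec c0; have [_ pD pM ph] := pt_hideal p.
pose tau i l := comp N (sigma i 0 l).
have contr i : f i * (c@_0%MM)%:MP = - \sum_l 'X_l * tau i l.
  have e : f i * c = - contraction (radial_field F n) (sigma i).
    apply: scalew_inj; rewrite -radial_wedge11 // -fth -scalemxAr ec.
    by rewrite scalerA.
  have := congr1 (fun g => comp N.+1 g) e.
  rewrite (compM _ _ (fN i)) leqnn subnn comp0E => ->.
  rewrite pihomogN; congr (- _); rewrite /contraction raddf_sum; apply: eq_bigr => l _ /=.
  by rewrite mxE (compM _ _ (dhomogXU _ l)) /= subn1.
have glue l i k : pt_ideal p ('X_k ^+ N.+1 * tau i l - 'X_i ^+ N.+1 * tau k l).
  have [|g eg] := exact (eta := f k *: sigma i - f i *: sigma k).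
    by rewrite wedge11B !wedge11Z -(fth i) -(fth k) !scalerA (mulrC (f k)) subrr.
  have pg : pt_ideal p (f k * tau i l - f i * tau k l).
    have /rowP/(_ l) := eg; rewrite !mxE => e.
    have := ph (N.+1 + N)%N _ (pM g _ (pw l)); rewrite -e pihomogB /=.
    by rewrite !(compM _ _ (fN _)) leq_addr addKn.
  rewrite (_ : _ - _ = (f k * tau i l - f i * tau k l)
    - tau i l * (f k - 'X_k ^+ N.+1) + tau k l * (f i - 'X_i ^+ N.+1)); last by ring.
  by apply: ptD; [apply: ptB|]; rewrite //; apply: ptMl.
have [i0 nX] := pt_notX p.
have [l nl] : exists l, ~ pt_ideal p (tau i0 l).
  apply/existsNP => pt; have : pt_ideal p (f i0 * (c@_0%MM)%:MP).
    rewrite contr -mulN1r; apply: ptMl; apply: hideal_sum => [|l _].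
      exact: pt_hideal.
    by apply: ptMl.
  case/pt_prime => [pfi|]; last exact: ptC.
  apply: nX; apply: (@pt_prime_exp _ _ _ _ N.+1).
  by rewrite -[_ ^+ _](subKr (f i0)); apply: ptB.
have /choice[lam Hlam] : forall j, exists lam : F,
    pt_ideal p ('X_j * tau i0 l - lam *: 'X_i0 ^+ N.+1).
  move=> j; apply: (@regular_function_constant _ _ _ _ (fun i => 'X_j * tau i l)) nX.
    by move=> i; exact: (dhomogM (dhomogXU _ j) (pihomogP _ N _)).
  move=> i k; rewrite (_ : _ - _ = 'X_j * ('X_k ^+ N.+1 * tau i l
    - 'X_i ^+ N.+1 * tau k l)); last by ring.
  exact: ptMl.
have lam0 : lam i0 != 0.
  apply/eqP => e; have := Hlam i0; rewrite e scale0r subr0.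
  by case/pt_prime.
exists i0, (fun j => lam j / lam i0) => j.
have : pt_ideal p (tau i0 l * ('X_j - (lam j / lam i0) *: 'X_i0)).
  rewrite (_ : _ * _ = ('X_j * tau i0 l - lam j *: 'X_i0 ^+ N.+1)
    - (lam j / lam i0)%:MP * ('X_i0 * tau i0 l - lam i0 *: 'X_i0 ^+ N.+1)).
    by apply: ptB => //; apply: ptMl.
  have -> : lam j *: 'X_i0 ^+ N.+1 = (lam j / lam i0)%:MP * (lam i0 *: 'X_i0 ^+ N.+1).
    by rewrite mul_mpolyC scalerA divfK.
  by rewrite -mul_mpolyC; ring.
by case/pt_prime.
Qed.

End Residue.

(** * Connectedness of the Kupka scheme *)

(** Each term of the binomial expansion is divisible by the K-th power of u or
    of v. *)
Lemma exprDn_half (R : comNzRingType) K (u v : R) :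
  exists r q, (u + v) ^+ (K + K) = u ^+ K * r + v ^+ K * q.
Proof.
exists (\sum_(t < (K + K).+1 | (t <= K)%N) u ^+ (K - t) * v ^+ t *+ 'C(K + K, t)).
exists (\sum_(t < (K + K).+1 | ~~ (t <= K)%N)
  u ^+ (K + K - t) * v ^+ (t - K) *+ 'C(K + K, t)).
rewrite exprDn (bigID (fun t : 'I_(K + K).+1 => (t <= K)%N)) /= !mulr_sumr.
congr (_ + _); apply: eq_bigr => t tK.
  by rewrite -addnBA // exprD -mulrA mulrnAr.
by rewrite -ltnNge in tK; rewrite mulrnAr mulrCA -exprD subnKC // ltnW.
Qed.

Section Scaling.
Variables (R : comPzRingType) (V : lmodType R).
Implicit Types (x y a b : R) (D T : V).

Lemma scale_swap x y a b D T :
  y *: (a *: D - x *: T) =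
  (y *: (a *: D) - x *: (b *: D)) + x *: (b *: D - y *: T).
Proof. by rewrite !scalerBr addrA subrK !scalerA (mulrC y x). Qed.

Lemma scale_compl a b D T :
  b *: D - (a + b) *: (D - T) = - (a *: D - (a + b) *: T).
Proof.
rewrite scalerBr !opprB (scalerDl D) opprD addrCA; congr (_ + _).
by rewrite addrCA subrr addr0.
Qed.

Lemma scale_error x y b D T :
  (x * y) *: T = (x * b) *: D - x *: (b *: D - y *: T).
Proof. by rewrite scalerBr !scalerA opprB addrC subrK. Qed.
End Scaling.

Section Kupka.

Variables (F : closedFieldType) (n d : nat).
Local Notation S := {mpoly F[n.+1]}.
Local Notation comp d f := (pihomog (@mdeg n.+1) d f).
Hypothesis charF : forall k, k.+1%:R != 0 :> F.
Hypothesis n3 : (3 <= n)%N.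
Variable w : 'rV[S]_n.+1.
Hypothesis w0 : w != 0.
Hypothesis wd : forall i, w 0 i \is d.-homog.
Hypothesis exact : forall eta, wedge11 w eta = 0 -> exists g, eta = g *: w.
Hypothesis radial0 : contraction (radial_field F n) w = 0.

Local Notation I := (ideal_I w).
Local Notation dw := (exterior_d w).

Lemma ideal_I_hideal : hideal I.
Proof.
split.
- by exists 0; rewrite scale0r wedge11_0.
- by move=> u v [eta eu] [zeta ev]; exists (eta + zeta); rewrite wedge11D scalerDl eu ev.
- by move=> a u [eta eu]; exists (a *: eta); rewrite wedge11Z -eu scalerA.
move=> k h [eta eh].
have e : comp k h *: dw = map_mx (pihomog (@mdeg n.+1) (d.-1 + k)) (wedge11 w eta).
  rewrite -eh; apply/matrixP => i j; rewrite [LHS]mxE [RHS]mxE [in RHS]mxE mulrC.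
  by rewrite [in RHS]mulrC (compM _ _ (exterior_d_homog i j wd)) leq_addr addKn.
exists (if (d <= d.-1 + k)%N
  then map_mx (pihomog (@mdeg n.+1) (d.-1 + k - d)) eta else 0).
by rewrite e (map_comp_wedge11 _ _ wd); case: ifP => //; rewrite wedge11_0.
Qed.

Lemma ideal_I_one : ~ I 1.
Proof.
move=> [eta]; rewrite scale1r => e.
have e' : d.+1%:R = - contraction (radial_field F n) eta.
  by apply: (scalew_inj w0); rewrite -(radial_exterior_d wd radial0) e radial_wedge11.
have : irrelevant_ideal (d.+1%:R : S).
  rewrite e' /contraction; exists (fun i => - eta 0 i).
  by rewrite -sumrN; apply: eq_bigr => i _; rewrite mxE mulNr mulrC.
move/irrelevantP; rewrite -mpolyC_nat mcoeffC eqxx mulr1 => /eqP.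
by apply/negP; exact: charF.
Qed.

(** Omega^2 / (w /\ Omega^1) has depth at least one at the zero locus of three
    regular elements. *)
Lemma ideal_I_regular (y : nat -> S) (t : S) :
  regular_seq y 3 -> (forall a, (a < 3)%N -> I (t * y a)) -> I t.
Proof.
move=> reg Iy; pose L : {linear 'rV[S]_n.+1 -> 'M[S]_n.+1} := wedge11 w.
have [|zeta e] := @coker_depth1 _ _ _ _ L w w0 (wedge11_self w) exact y (t *: dw) reg.
  by move=> a /Iy[eta e]; exists eta; rewrite scalerA mulrC.
by exists zeta.
Qed.

Lemma inord_inj4 : {in gtn 4 &, injective (fun a => inord a : 'I_n.+1)}.
Proof.
move=> a b; rewrite !inE => a4 b4 /(congr1 val).
by rewrite /= !inordK // (leq_trans _ (n3 : 3 < n.+1)%N).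
Qed.

Lemma ideal_I_zero : exists p, I `<=` pt_ideal p.
Proof.
apply: contrapT => /forallNP np; apply: ideal_I_one.
have /choice[k Hk] : forall i : 'I_n.+1, exists k, I ('X_i ^+ k).
  move=> i; apply: (zero_locus_power ideal_I_hideal _ (dhomogXU _ i)) => // p Ip.
  by have [] := np p.
have [_ _ IM _] := ideal_I_hideal.
pose N := (\sum_i k i)%N.
apply: (@ideal_I_regular (fun a => 'X_(inord a) ^+ N)).
  by apply: (@regular_seqW _ _ _ 4) => //; apply: regular_Xn; exact: inord_inj4.
move=> a _; rewrite mul1r.
have kN : (k (inord a) <= N)%N by rewrite /N (bigD1 (inord a)) //= leq_addr.
by rewrite -(subnK kN) exprD; apply: IM.
Qed.

(** If a closed point q were isolated, powers of three of its equations would be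
    in I at q, and then so would be a unit, by ideal_I_regular. Hence a prime
    containing I and contained in q avoids one of these equations. *)
Lemma nonlinear_point_below (q : proj_point F n) : I `<=` pt_ideal q ->
  exists p, [/\ I `<=` pt_ideal p, pt_ideal p `<=` pt_ideal q & ~ linear_point p].
Proof.
move=> Iq; have [[k [mu qmu]]|nlin] := pselect (linear_point q);
  last by exists q; split.
pose s a : 'I_n.+1 := inord (bump k a).
have bump3 a : (a < 3)%N -> (bump k a < n.+1)%N.
  move=> a3; rewrite ltnS /bump; apply: leq_trans n3.
  by rewrite -[3%N]/(1 + 2)%N leq_add ?leq_b1.
have sinj : {in gtn 3 &, injective s}.
  move=> a b; rewrite !inE => a3 b3 /(congr1 val).
  by rewrite /= !inordK ?bump3 // => /(can_inj (@bumpK k)).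
have sk a : (a < 3)%N -> s a != k.
  by move=> a3; rewrite -val_eqE /= inordK ?bump3 // eq_sym neq_bump.
pose y a : S := 'X_(s a) - mu (s a) *: 'X_k.
have ey a N : (a < 3)%N -> ('X_(s a) \mPo shear k mu) ^+ N = y a ^+ N.
  by move=> a3; rewrite shearX (negbTE (sk _ a3)).
have yd a : y a \is 1.-homog by rewrite rpredB ?rpredZ ?dhomogXU.
have [a [a3 Ha]] : exists a, (a < 3)%N /\
    forall t N l, t \is l.-homog -> ~ pt_ideal q t -> ~ I (t * y a ^+ N).
  apply: contrapT => /forallNP na.
  have [_ _ IM _] := ideal_I_hideal.
  have pw a : (a < 3)%N -> exists t N, ~ pt_ideal q t /\ I (t * y a ^+ N).
    move=> a3; apply: contrapT => nt; apply: (na a); split=> // t N l _ qt It.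
    by apply: nt; exists t, N.
  have [t0 [N0 [qt0 I0]]] := pw 0%N isT.
  have [t1 [N1 [qt1 I1]]] := pw 1%N isT.
  have [t2 [N2 [qt2 I2]]] := pw 2%N isT.
  suff : I (t0 * t1 * t2) by move/Iq => /pt_prime[/pt_prime[]|].
  apply: (@ideal_I_regular (fun a => ('X_(s a) \mPo shear k mu) ^+ (N0 + N1 + N2))).
    exact: regular_shear.
  have Ile r t u K M : I (t * u ^+ K) -> (K <= M)%N -> I (r * (t * u ^+ M)).
    move=> It KM; suff -> : r * (t * u ^+ M) = r * u ^+ (M - K) * (t * u ^+ K).
      exact: IM.
    by rewrite -{1}(subnK KM) exprD; move: (u ^+ (M - K)) (u ^+ K) => v v'; ring.
  have swap (r t v z : S) : r * t * v * z = t * v * (r * z) by ring.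
  move=> a a3; rewrite (ey a _ a3); case: a a3 => [|[|[|a]]] a3; last by [].
  - by rewrite swap; apply: (Ile _ _ _ N0) => //; rewrite -addnA leq_addr.
  - rewrite (mulrC t0) swap; apply: (Ile _ _ _ N1) => //.
    by rewrite addnAC leq_addl.
  - by rewrite (mulrC _ t2) mulrA swap; apply: (Ile _ _ _ N2) => //; rewrite leq_addl.
pose T : set S := [set u | exists t N l,
  [/\ t \is l.-homog, ~ pt_ideal q t & u = t * y a ^+ N]].
have q1 : ~ pt_ideal q 1 by exact: pt1.
have Ty : T (y a) by exists 1, 1%N, 0%N; split=> //; [exact: dhomog1|rewrite mul1r].
have [|||||p [Ip pT]] := @exists_point _ _ I T (y a) ideal_I_hideal _ Ty.
- exact: homog_irrelevant (yd a).
- by exists 1, 0%N, 0%N; split=> //; [exact: dhomog1|rewrite mul1r].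
- move=> _ _ [t [N [l [tl qt ->]]]] [t' [N' [l' [tl' qt' ->]]]].
  exists (t * t'), (N + N')%N, (l + l')%N; split; first exact: dhomogM.
    by case/pt_prime.
  by rewrite exprD mulrACA.
- move=> _ [t [N [l [tl _ ->]]]]; exists (l + 1 * N)%N.
  by apply: dhomogM => //; exact: dhomogMn.
- by move=> _ [t [N [l [tl qt ->]]]]; exact: Ha tl qt.
have pq : pt_ideal p `<=` pt_ideal q.
  move=> f pf; rewrite [f]comp_sum; apply: hideal_sum => [|l _].
    exact: pt_hideal.
  apply: contrapT => nq; have [_ _ _ ph] := pt_hideal p.
  apply: (pT _ _ (ph l _ pf)); exists (comp l f), 0%N, (l : nat).
  by split=> //; [exact: pihomogP|rewrite mulr1].
exists p; split=> // /(sub_linear_point pq qmu) /(_ (s a)).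
exact: pT.
Qed.

(** Idempotents separating two disjoint closed parts of the zero locus of I, in
    homogeneous form: the fractions a_i / X_i^(N+1) and b_i / X_i^(N+1) glue to the
    functions 0, 1 on the first part and 1, 0 on the second. High powers of a + b
    split accordingly into two terms, whose products lie in I itself and not only
    in all the points of its zero locus. *)
Lemma separating_functions (A1 A2 : set S) :
    (forall p, I `<=` pt_ideal p -> A1 `<=` pt_ideal p \/ A2 `<=` pt_ideal p) ->
    (forall p, I `<=` pt_ideal p -> A1 `<=` pt_ideal p -> ~ A2 `<=` pt_ideal p) ->
  exists N (a b : 'I_n.+1 -> S),
    [/\ forall i, [/\ a i \is N.+1.-homog, b i \is N.+1.-homog &
                      'X_i ^+ N.+1 = a i + b i],
        forall i j, I (a i * b j),
        forall p, I `<=` pt_ideal p -> A1 `<=` pt_ideal p ->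
          forall i, pt_ideal p (a i) &
        forall p, I `<=` pt_ideal p -> A2 `<=` pt_ideal p ->
          forall i, pt_ideal p (b i)].
Proof.
move=> cover disj; have HI := ideal_I_hideal; have [_ ID IM _] := HI.
pose B A : set S := [set f | forall p, I `<=` pt_ideal p -> A `<=` pt_ideal p ->
  pt_ideal p f].
have HB A : hideal (B A).
  split.
  - by move=> p _ _; case: (pt_hideal p).
  - by move=> u v Bu Bv p Ip Ap; apply: ptD; [exact: Bu|exact: Bv].
  - by move=> a u Bu p Ip Ap; apply: ptMl; exact: Bu.
  - by move=> k u Bu p Ip Ap; case: (pt_hideal p) => _ _ _; apply; exact: Bu.
pose B12 : set S := [set f | exists u v, [/\ B A1 u, B A2 v & f = u + v]].
have HB12 : hideal B12.
  have [B10 B1D B1M B1h] := HB A1; have [B20 B2D B2M B2h] := HB A2; split.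
  - by exists 0, 0; rewrite addr0.
  - move=> _ _ [u [v [Bu Bv ->]]] [u' [v' [Bu' Bv' ->]]].
    by exists (u + u'), (v + v'); split; [exact: B1D|exact: B2D|rewrite addrACA].
  - move=> c _ [u [v [Bu Bv ->]]]; exists (c * u), (c * v).
    by split; [exact: B1M|exact: B2M|rewrite mulrDr].
  - move=> k _ [u [v [Bu Bv ->]]]; exists (comp k u), (comp k v).
    by split; [exact: B1h|exact: B2h|rewrite pihomogD].
have /choice[k Hk] : forall i : 'I_n.+1, exists k, B12 ('X_i ^+ k).
  move=> i; apply: (zero_locus_power HB12 _ (dhomogXU _ i)) => // p Bp; exfalso.
  have sub A : B A `<=` pt_ideal p -> I `<=` pt_ideal p /\ A `<=` pt_ideal p.
    by move=> BA; split=> f Af; apply: BA => q Iq Aq; [exact: Iq|exact: Aq].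
  have [Ip A1p] : I `<=` pt_ideal p /\ A1 `<=` pt_ideal p.
    apply: sub => f Bf; apply: Bp; exists f, 0; rewrite addr0; split=> //.
    by case: (HB A2).
  have [_ A2p] : I `<=` pt_ideal p /\ A2 `<=` pt_ideal p.
    apply: sub => f Bf; apply: Bp; exists 0, f; rewrite add0r; split=> //.
    by case: (HB A1).
  exact: disj Ip A1p A2p.
pose M := (\sum_i k i)%N.+1.
have /choice[ab Hab] : forall i : 'I_n.+1, exists ab : S * S,
    [/\ ab.1 \is M.-homog, ab.2 \is M.-homog, B A1 ab.1, B A2 ab.2 &
        'X_i ^+ M = ab.1 + ab.2].
  move=> i; have kM : (k i <= M)%N by rewrite /M (bigD1 i) //= -addnS leq_addr.
  have [_ _ B12M _] := HB12.
  have [u [v [Bu Bv e]]] : B12 ('X_i ^+ M).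
    by rewrite -(subnK kM) exprD; apply: B12M.
  exists (comp M u, comp M v) => /=; split; try exact: pihomogP.
  - by case: (HB A1) => _ _ _; apply.
  - by case: (HB A2) => _ _ _; apply.
  - by rewrite -pihomogD -e pihomog_dE // dhomogXUn.
have /choice[l Hl] : forall ij : 'I_n.+1 * 'I_n.+1, exists l,
    I (((ab ij.1).1 * (ab ij.2).2) ^+ l).
  move=> [i j] /=; have [ai _ B1 _ _] := Hab i; have [_ bj _ B2 _] := Hab j.
  apply: (zero_locus_power HI _ (dhomogM ai bj)) => // p Ip.
  by have [Ap|Ap] := cover _ Ip; [apply: ptMr; exact: B1|apply: ptMl; exact: B2].
pose K := (\sum_ij l ij)%N.+1.
have IabK i j : I (((ab i).1 * (ab j).2) ^+ K).
  have lK : (l (i, j) <= K)%N by rewrite /K (bigD1 (i, j)) //= -addnS leq_addr.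
  by rewrite -(subnK lK) exprD; apply: IM; exact: (Hl (i, j)).
have /choice[rq Hrq] : forall i, exists rq : S * S,
    'X_i ^+ (M * (K + K)) = (ab i).1 ^+ K * rq.1 + (ab i).2 ^+ K * rq.2.
  move=> i; have [r [q e]] := exprDn_half K (ab i).1 (ab i).2; exists (r, q).
  by rewrite -e exprM; have [_ _ _ _ ->] := Hab i.
have /prednK eN : (0 < M * (K + K))%N by rewrite muln_gt0.
set N := (M * (K + K)).-1 in eN.
have cN (u r : S) : u \is M.-homog -> exists r', comp N.+1 (u ^+ K * r) = u ^+ K * r'.
  move=> uM; rewrite (compM _ _ (dhomogMn K uM)); case: ifP => _.
    by exists (comp (N.+1 - M * K) r).
  by exists 0; rewrite mulr0.
exists N, (fun i => comp N.+1 ((ab i).1 ^+ K * (rq i).1)),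
  (fun i => comp N.+1 ((ab i).2 ^+ K * (rq i).2)).
split=> [i|i j|p Ip Ap i|p Ip Ap i].
- split; try exact: pihomogP.
  by rewrite -pihomogD -Hrq -eN pihomog_dE // dhomogXUn.
- have [ai _ _ _ _] := Hab i; have [_ bj _ _ _] := Hab j.
  have [r' ->] := cN _ (rq i).1 ai; have [q' ->] := cN _ (rq j).2 bj.
  by rewrite mulrACA -exprMn mulrC; apply: IM; exact: IabK.
- have [ai _ B1 _ _] := Hab i; have [r' ->] := cN _ (rq i).1 ai.
  by rewrite exprS -mulrA; apply: ptMr; exact: B1.
- have [_ bi _ B2 _] := Hab i; have [r' ->] := cN _ (rq i).2 bi.
  by rewrite exprS -mulrA; apply: ptMr; exact: B2.
Qed.

(** The functions of separating_functions times dw define a cocycle with values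
    in Omega^2 / (w /\ Omega^1), hence a global theta which is divisible by w near
    the first part and congruent to dw near the second. Its contraction with the
    radial field is c w; the constants c at the first part and d + 1 - c at the
    second are both zero, whereas their sum is not. *)
Lemma zero_locus_connected (A1 A2 : set S) :
    (forall p, I `<=` pt_ideal p -> forall i, pt_ideal p (w 0 i)) ->
    (forall p, I `<=` pt_ideal p -> A1 `<=` pt_ideal p \/ A2 `<=` pt_ideal p) ->
    (forall p, I `<=` pt_ideal p -> A1 `<=` pt_ideal p -> ~ A2 `<=` pt_ideal p) ->
    (exists p, I `<=` pt_ideal p /\ A1 `<=` pt_ideal p) ->
    (exists p, I `<=` pt_ideal p /\ A2 `<=` pt_ideal p) ->
  False.
Proof.
move=> Jp cover disj [q1 [Iq1 Aq1]] [q2 [Iq2 Aq2]].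
have HI := ideal_I_hideal; have [_ ID IM _] := HI.
have [N [a [b [ab Iab a1 b2]]]] := separating_functions cover disj.
pose L : {linear 'rV[S]_n.+1 -> 'M[S]_n.+1} := wedge11 w.
have cocycle i j : exists eta,
    'X_i ^+ N.+1 *: (a j *: dw) - 'X_j ^+ N.+1 *: (a i *: dw) = wedge11 w eta.
  have [_ _ ->] := ab i; have [_ _ ->] := ab j.
  suff [eta e] : I (a j * b i - a i * b j).
    exists eta; rewrite -e !scalerA -scalerBl; congr (_ *: _); ring.
  exact: hidealB.
have reg4 := @regular_Xn F n.+1 _ N.+1 4 inord_inj4.
have [theta4 Hth4] := @coker_depth2 _ _ _ _ L w w0 (wedge11_self w) exact
  (fun t => 'X_(inord t) ^+ N.+1) (fun t => a (inord t) *: dw) reg4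
  (fun i j => cocycle (inord i) (inord j)).
pose theta : 'M[S]_n.+1 := theta4.
have Hth i : exists zeta, a i *: dw - 'X_i ^+ N.+1 *: theta = wedge11 w zeta.
  apply: (@coker_depth1 _ _ _ _ L w w0 (wedge11_self w) exact
    (fun t => 'X_(inord t) ^+ N.+1)).
    exact: regular_seqW reg4.
  move=> t t3; have [eta e] := cocycle (inord t) i.
  have [zeta ez] := Hth4 t (ltnW t3).
  exists (eta + 'X_i ^+ N.+1 *: zeta).
  have -> : L (eta + 'X_i ^+ N.+1 *: zeta) = wedge11 w eta + 'X_i ^+ N.+1 *: L zeta.
    by rewrite -wedge11Z -wedge11D.
  rewrite -e -ez; exact: scale_swap.
have [c ec] : exists c, radial_field F n *m theta = c *: w.
  have multiple i : exists g, 'X_i ^+ N.+1 *: (radial_field F n *m theta) = g *: w.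
    have [zeta ez] := Hth i.
    exists (a i * d.+1%:R + contraction (radial_field F n) zeta).
    have := congr1 (mulmx (radial_field F n)) ez.
    rewrite mulmxBr -!scalemxAr (radial_exterior_d wd radial0) radial_wedge11 //.
    move=> e; rewrite scalerDl -scalerA -[X in _ + X]opprK -scaleNr -e.
    by rewrite opprB addrC subrK.
  have [g0 e0] := multiple (inord 0); have [g1 e1] := multiple (inord 1).
  have [||C [eC _]] := @regular_cocycle1 _ 1 1 (fun t => 'X_(inord t) ^+ N.+1)
      g0%:M g1%:M.
  - exact: regular_seqW reg4.
  - rewrite !scale_scalar_mx; congr (_%:M); apply: (scalew_inj w0).
    by rewrite -!scalerA -e0 -e1 !scalerA mulrC.
  exists (C 0 0); apply: (scalemx_inj (regular_neq0 reg4 isT)).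
  rewrite e0 scalerA; congr (_ *: _).
  by have /matrixP/(_ 0 0) := eC; rewrite !mxE mulr1n.
have part (x y : 'I_n.+1 -> S) (th : 'M[S]_n.+1) (c' : S) p : I `<=` pt_ideal p ->
    (forall i, x i \is N.+1.-homog) -> (forall i, 'X_i ^+ N.+1 = x i + y i) ->
    (forall i, pt_ideal p (y i)) -> (forall i, I (x i * y i)) ->
    (forall i, exists zeta, y i *: dw - 'X_i ^+ N.+1 *: th = wedge11 w zeta) ->
    radial_field F n *m th = c' *: w -> c'@_0%MM != 0 -> linear_point p.
  move=> Ip xN xy py Ixy Hz ec' c'0.
  have /choice[sigma Hs] : forall i, exists s,
      (x i * 'X_i ^+ N.+1) *: th = wedge11 w s.
    move=> i; have [zeta ez] := Hz i; have [eta ee] := Ixy i.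
    exists (eta - x i *: zeta); rewrite wedge11B wedge11Z -ee -ez.
    exact: scale_error.
  apply: (@residue_linear_point _ _ _ w0 exact radial0 p th
    (fun i => x i * 'X_i ^+ N.+1) sigma (N + N.+1)%N c' (Jp _ Ip) Hs _ _ ec' c'0).
    by move=> i; exact: (dhomogM (xN i) (dhomogXUn _ i N.+1)).
  move=> i; rewrite -[(N + N.+1).+1]/(N.+1 + N.+1)%N exprD -mulrBl; apply: ptMr.
  by rewrite xy opprD addrA subrr sub0r -mulN1r; apply: ptMl.
have [p1 [Ip1 p1q1 nl1]] := nonlinear_point_below Iq1.
have [p2 [Ip2 p2q2 nl2]] := nonlinear_point_below Iq2.
have Ap1 : A1 `<=` pt_ideal p1.
  case: (cover _ Ip1) => // A2p1; case: (disj _ Iq1 Aq1).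
  exact: subset_trans p1q1.
have Ap2 : A2 `<=` pt_ideal p2.
  case: (cover _ Ip2) => // A1p2; case: (disj _ Iq2) => //.
  exact: subset_trans p2q2.
have c0 : c@_0%MM = 0.
  apply/eqP/negPn/negP => c0; apply: nl1; apply: (part b a theta c) => //.
  - by move=> i; have [] := ab i.
  - by move=> i; have [_ _ ->] := ab i; rewrite addrC.
  - exact: a1.
  - by move=> i; rewrite mulrC.
apply: nl2; apply: (part a b (dw - theta) (d.+1%:R - c)) => //.
- by move=> i; have [] := ab i.
- by move=> i; have [] := ab i.
- exact: b2.
- move=> i; have [zeta ez] := Hth i; exists (- zeta).
  rewrite -[- zeta]sub0r wedge11B wedge11_0 sub0r -ez.
  by have [_ _ ->] := ab i; exact: scale_compl.
- by rewrite mulmxBr (radial_exterior_d wd radial0) ec scalerBl.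
- rewrite mcoeffB c0 subr0 -mpolyC_nat mcoeffC eqxx mulr1; exact: charF.
Qed.

End Kupka.

(** The Kupka scheme is supported on the zero locus of ideal_I w: division points
    are those off this locus, and ideal_I w annihilates dw modulo ideal_J w. *)
Theorem kupka_connected (F : closedFieldType) (n e : nat)
    (w : 'rV[{mpoly F[n.+1]}]_n.+1) :
    (forall k, k.+1%:R != 0 :> F) -> (3 <= n)%N -> in_U e w ->
  kupka w !=set0 /\ connected (kupka w).
Proof.
move=> charF n3 [[[wd radial0] w0 cod _] div].
have exact eta : wedge11 w eta = 0 -> exists g, eta = g *: w.
  by apply: wedge11_eq0 wd w0 cod; apply: leq_trans n3.
have Ikupka p : ideal_I w `<=` pt_ideal p -> kupka w p.
  move=> Ip; apply: contrapT => /div[h [s [Ih ps e1]]].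
  have s0 : s != 0.
    by apply/eqP => e0; apply: ps; rewrite e0; case: (pt_hideal p).
  apply: ps; suff -> : s = h by exact: Ip.
  apply/eqP; rewrite -tofrac_eq; apply/eqP.
  by rewrite -[LHS]mul1r e1 divfK // tofrac_eq0.
have kupkaI p : kupka w p -> ideal_I w `<=` pt_ideal p.
  move=> Kp h [eta eh]; apply: Kp; exists h, 0; rewrite addr0; split=> //.
    move=> i j; rewrite eh mxE -mulrN mulrC [w 0 j * _]mulrC.
    by apply: ideal_JD; apply: ideal_JM; exact: ideal_JP.
  exact: ideal_J0.
have kupkaJ p i : kupka w p -> pt_ideal p (w 0 i).
  move=> Kp; apply: Kp; exists 0, (w 0 i); rewrite add0r; split=> //.
    by move=> k l; rewrite scale0r mxE; exact: ideal_J0.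
  exact: ideal_JP.
split.
  have [p Ip] := ideal_I_zero charF n3 w0 wd exact radial0.
  by exists p; exact: Ikupka.
move=> B [q Bq] [C oC BC] [C' cC' BC']; apply/seteqP; split.
  by rewrite BC => p [].
move=> p Kp; apply: contrapT => nBp.
have [A1 eA1] : exists A, C = ~` zero_locus A by exact: oC.
have [A2 eA2] : exists A, ~` C' = ~` zero_locus A.
  by have : open (~` C') by exact: closed_openC.
have {}eA2 : C' = zero_locus A2 by rewrite -[LHS]setCK eA2 setCK.
have inB x : B x -> A2 `<=` pt_ideal x by rewrite BC' eA2 => -[].
have notB x : kupka w x -> ~ B x -> A1 `<=` pt_ideal x.
  by move=> Kx nB; apply: contrapT => nA; apply: nB; rewrite BC eA1; split.
apply: (zero_locus_connected charF n3 w0 wd exact radial0 (A1 := A2) (A2 := A1)).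
- by move=> x Ix i; apply/kupkaJ/Ikupka.
- move=> x /Ikupka Kx; have [/inB|/(notB _ Kx)] := pselect (B x); by [left|right].
- move=> x /Ikupka Kx A2x; have : B x by rewrite BC' eA2; split.
  by rewrite BC eA1 => -[].
- exists q; split; last exact: inB.
  by apply: kupkaI; move: Bq; rewrite BC => -[].
- by exists p; split; [exact: kupkaI|exact: notB].
Qed.

Theorem theorem1 (R : realType) (n e : nat)
    (w : 'rV[{mpoly R[i][n.+1]}]_n.+1) :
  (3 <= n)%N -> in_U e w -> kupka w !=set0 /\ connected (kupka w).
Proof.
apply: kupka_connected => k.
by rewrite Num.Theory.pnatr_eq0.
Qed.
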